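(* Let $v \geq 3$ be an integer. There exists a $\mathrm{TTS}(v)$ with a Hamiltonian $2$-BIG if and only if $v \equiv 0$ or $1 \pmod 3$ and $v \notin \{3,6\}$.
   Context: A twofold triple system of order $v$, denoted $\mathrm{TTS}(v)$, is a pair $(V,\mathcal{B})$ where $V$ is a set of $v$ points and $\mathcal{B}$ is a collection of $3$-element subsets of $V$ (called blocks or triples; repeated blocks are permitted, i.e. $\mathcal{B}$ is a multiset) such that each $2$-element subset of $V$ is contained in exactly two blocks of $\mathcal{B}$, counted with multiplicity. The $2$-block-intersection graph ($2$-BIG) of $(V,\mathcal{B})$ is the graph whose vertices are the blocks in $\mathcal{B}$ (repeated blocks giving distinct vertices), where two vertices $B_1,B_2$ are adjacent if and only if $|B_1\cap B_2|=2$. A graph is Hamiltonian if it contains a Hamilton cycle (a cycle, of length at least $3$, through all vertices). *)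

(* Defs.v *)
From HB Require Import structures.
From mathcomp Require Import all_boot.

Set Implicit Arguments.
Unset Strict Implicit.
Unset Printing Implicit Defensive.

(* The multiset of blocks is a family [block] indexed by a finite type, so
   that a repeated block has several indices, and counting indices counts
   blocks with multiplicity. *)
Record TTS (v : nat) := MkTTS {
  point : finType;
  block_index : finType;
  block : block_index -> {set point};
  card_point : #|point| = v;
  card_block : forall i : block_index, #|block i| = 3;
  pair_in_two_blocks : forall P : {set point}, #|P| = 2 ->
    #|[set i : block_index | P \subset block i]| = 2
}.

Definition two_BIG (v : nat) (S : TTS v) : rel (block_index S) :=
  fun i j => #|block i :&: block j| == 2.
Arguments two_BIG {v} S i j.

Definition hamilton_cycle (T : finType) (e : rel T) (c : seq T) : Prop :=
  [/\ 3 <= size c, ucycle e c & forall x : T, x \in c].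

Definition hamiltonian (T : finType) (e : rel T) : Prop :=
  exists c : seq T, hamilton_cycle e c.

(* Main.v *)
Require Import Defs.
From mathcomp Require Import all_boot all_algebra.
From mathcomp Require Import zify ring.

Set Implicit Arguments.
Unset Strict Implicit.
Unset Printing Implicit Defensive.

(** A Hamilton cycle of the 2-BIG is a cyclic list of [v (v - 1) / 3] triples
    in which consecutive triples share a pair; such a list gives a TTS as soon
    as every pair of points lies in at least two triples, by counting.

    For [v = 3n + 3] with [n >= 7] take the points [Z_n * {0, 1, 2}] and three
    further points [A], [B], [C]. The zigzag [0, 1, -1, 2, -2, ...] runs through
    [Z_n] with steps that realise every nonzero difference twice up to sign;
    three copies of it, one for each pair of levels, organise the blocks with
    two points of one level and one of another into three strands. Together
    with one block orbit inside level 0, one orbit of transversals and the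
    blocks through [A], [B] or [C], the strands form a strip from a pair to a
    translate of this pair by a generator of [Z_n]. The [n] translates of the
    strip close up to a single cycle that covers every pair except those inside
    [{A, B, C}]. Taking the block [A B C] twice and performing one Pasch trade
    yields a TTS and merges [A B C] into the cycle.

    The transversals and [A B C] are a parallel class. Joining a new point to
    the three pairs of each block of a parallel class turns a TTS of order [v]
    into one of order [v + 1]; in the 2-BIG, vertices are replaced by triangles,
    which preserves Hamiltonicity. Small orders are given by explicit lists.

    Conversely [v (v - 1) / 3] is an integer, a TTS of order 3 has two blocks,
    and for order 6 an exhaustive search finds no cyclic list. *)

(** * Strips *)

Section Triples.

Variable T : eqType.
Implicit Types (u w : T) (b : T * T * T).

Definition points b : seq T := [:: b.1.1; b.1.2; b.2].
Definition covers u w b : bool := (u \in points b) && (w \in points b).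

(* A triple [(u, w, z)] is the block [{u, w, z}] entered through the pair
   [{u, w}] and left through the pair [{w, z}]. *)
Definition next_triple b b' : bool :=
  (b'.1 == (b.1.2, b.2)) || (b'.1 == (b.2, b.1.2)).

End Triples.

Arguments points {T} b.
Arguments covers {T} u w b.
Arguments next_triple {T} b b'.

Section Strips.

Variable P : finType.
Implicit Types (u w : P) (b : P * P * P) (L : seq (P * P * P)).

Definition gray_strip L : Prop :=
  [/\ cycle next_triple L, all (fun b => uniq (points b)) L,
      3 * size L = #|P| * #|P|.-1 &
      forall u w, u != w -> 2 <= count (covers u w) L].

Lemma card_offdiag (A : {set P}) :
  \sum_(p : P * P | (p.1 != p.2) && (p.1 \in A) && (p.2 \in A)) 1
  = #|A| * #|A|.-1.
Proof.
rewrite (eq_bigl (fun p : P * P => (p.1 \in A) && (p.2 \in A :\ p.1))); last first.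
  by move=> [u w] /=; rewrite !inE [w == u]eq_sym; case: (u == w); case: (u \in A).
rewrite -(pair_big_dep (mem A) (fun u w => w \in A :\ u) (fun _ _ => 1)) /=.
rewrite (eq_bigr (fun _ => #|A|.-1)); last first.
  by move=> u uA; rewrite sum1_card (cardsD1 u A) uA.
by rewrite sum_nat_const.
Qed.

(** Double counting over ordered pairs: each triple covers six of them, so the total is
    [6 * size L], twice the number of ordered pairs. This equals the sum of the lower bounds, so
    every bound is attained. *)
Lemma gray_strip_exact L : gray_strip L ->
  forall u w, u != w -> count (covers u w) L = 2.
Proof.
case=> _ /allP L3 szL cov u w neq_uw.
have sum6 : \sum_(p : P * P | p.1 != p.2) count (covers p.1 p.2) L = 2 * (#|P| * #|P|.-1).
  under eq_bigr do rewrite -sum1_count big_mkcond.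
  rewrite exchange_big /= (eq_big_seq (fun _ => 6)).
    by rewrite big_const_seq count_predT iter_addn_0 -szL mulnA.
  move=> b /L3 ub; rewrite -big_mkcondr /=.
  have card3 : #|[set x in points b]| = 3.
    by rewrite cardsE (card_uniqP ub).
  transitivity (#|[set x in points b]| * #|[set x in points b]|.-1); last by rewrite card3.
  rewrite -card_offdiag; apply: eq_bigl => p.
  by rewrite /covers !in_set -andbA.
have/leqif_sum : forall p : P * P, p.1 != p.2 ->
    2 <= count (covers p.1 p.2) L ?= iff (2 == count (covers p.1 p.2) L).
  by move=> p /cov le2; split.
case=> _; rewrite sum6.
have -> : \sum_(i : P * P | i.1 != i.2) 2 = 2 * (#|P| * #|P|.-1).
  rewrite -[#|P|]cardsT -card_offdiag big_distrr /=.
  by apply: eq_bigl => p; rewrite !inE !andbT.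
by rewrite eqxx => /esym/forall_inP/(_ (u, w) neq_uw)/eqP/esym.
Qed.

Lemma nat_succ_mod i N : i < N -> i.+1 %% N < N.
Proof. by case: N => // N _; rewrite ltn_mod. Qed.

Lemma cycle_nth (T : eqType) (e : rel T) (s : seq T) x0 i :
  cycle e s -> i < size s -> e (nth x0 s i) (nth x0 s (i.+1 %% size s)).
Proof.
case: s => // x s; rewrite [cycle _ _]/= rcons_path => /andP[/(pathP x0) ps el].
rewrite [size _]/= ltnS leq_eqVlt => /orP[/eqP-> | lt_is].
  by rewrite modnn /=; rewrite (last_nth x0) in el.
by rewrite modn_small // ; apply: ps.
Qed.

Lemma cycle_iota_succ N : cycle (fun i j => j == i.+1 %% N) (iota 0 N).
Proof.
case: N => // N; apply/(pathP 0) => i.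
rewrite size_rcons size_iota ltnS => le_iN.
rewrite -(rcons_cons 0) !nth_rcons /= size_iota ltnS le_iN.
have -> : nth 0 (0 :: iota 1 N) i = i by rewrite -[_ :: _]/(iota 0 N.+1) nth_iota.
case: ltngtP le_iN => // [lt_iN|->] _; last by rewrite modnn.
by rewrite nth_iota // modn_small.
Qed.

Lemma gray_strip_hamiltonian L : 3 <= size L -> gray_strip L ->
  exists S : TTS #|P|, hamiltonian (two_BIG S).
Proof.
move=> szL3 gL; have exact2 := gray_strip_exact gL.
case: gL => cyc /allP L3 szL _.
case defL: L szL3 => [//|b0 L'] ; rewrite -defL => szL3.
pose N := size L; pose blk (i : 'I_N) : {set P} := [set x in points (nth b0 L i)].
have memL (i : 'I_N) : nth b0 L i \in L by rewrite mem_nth.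
have card3 i : #|blk i| = 3 by rewrite cardsE (card_uniqP (L3 _ (memL i))).
have cntE u w : #|[set i | [set u; w] \subset blk i]| = count (covers u w) L.
  rewrite -sum1_count (big_nth b0) big_mkord sum1dep_card.
  by apply: eq_card => i; rewrite !inE subUset !sub1set !in_set.
have two (A : {set P}) : #|A| = 2 -> #|[set i | A \subset blk i]| = 2.
  by move/eqP/cards2P=> [u [w [neq_uw ->]]]; rewrite cntE exact2.
pose S := MkTTS (erefl #|P|) card3 two.
exists S; exists (enum 'I_N); split.
- by rewrite size_enum_ord.
- rewrite /ucycle enum_uniq andbT.
  pose nx (i : 'I_N) : 'I_N := Ordinal (nat_succ_mod (ltn_ord i)).
  have stepL (i : 'I_N) : exists2 p : P * P, p.1 != p.2 &
      [/\ p.1 \in blk i, p.2 \in blk i, p.1 \in blk (nx i) & p.2 \in blk (nx i)].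
    have := cycle_nth b0 cyc (ltn_ord i); have := L3 _ (memL i).
    rewrite /blk /= -/N; case: (nth b0 L i) => [[u w] z].
    case: (nth b0 L (i.+1 %% N)) => [[u' w'] z'].
    rewrite /next_triple !xpair_eqE /= !inE !negb_or => /andP[/andP[_ _] /andP[neq _]].
    by case/orP=> /andP[/eqP-> /eqP->]; exists (w, z); rewrite //= !in_set /= !inE !eqxx ?orbT.
  have bigS (i : 'I_N) : two_BIG S i (nx i).
    rewrite /two_BIG /=; have [[u w] /= nuw [ui wi uj wj]] := stepL i.
    have : 2 <= #|blk i :&: blk (nx i)|.
      have <- : #|[set u; w]| = 2 by rewrite cards2 nuw.
      by apply: subset_leq_card; rewrite subsetI !subUset !sub1set ui wi uj wj.
    (* If blocks [i] and [i + 1] coincided as sets, the pair shared by blocks [i + 1] and [i + 2]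
       would lie in three blocks with distinct indices, against [exact2]. *)
    rewrite leq_eqVlt eq_sym => /orP[// | gt2].
    have sub1 : blk i :&: blk (nx i) = blk (nx i).
      by apply/eqP; rewrite eqEcard subsetIr card3.
    have sub : blk (nx i) \subset blk i by rewrite -sub1 subsetIl.
    have [[u' w'] /= nuw' [ui' wi' uj' wj']] := stepL (nx i).
    have := cntE u' w'; rewrite exact2 // => card2.
    suff : 3 <= #|[set j | [set u'; w'] \subset blk j]| by rewrite card2.
    have uq : uniq [:: i; nx i; nx (nx i)].
      have neqmod k d : k < N -> 0 < d < 3 -> (k + d) %% N != k.
        move=> kN /andP[d0 d3]; rewrite -{2}(modn_small kN) -{2}[k]addn0 eqn_modDl.
        by rewrite mod0n modn_small -?lt0n // (leq_trans d3).
      have n1 j : j != nx j by rewrite eq_sym -val_eqE /= -addn1 neqmod.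
      rewrite /= !inE negb_or !n1 !andbT /= eq_sym -val_eqE /=.
      by rewrite -addn1 -[i.+1]addn1 modnDml -addnA neqmod.
    rewrite -(card_uniqP uq : #|mem [:: i; nx i; nx (nx i)]| = 3).
    apply: subset_leq_card; apply/subsetP => j jI; rewrite in_set subUset !sub1set.
    rewrite !inE in jI; case/or3P: jI => /eqP->; last by rewrite uj' wj'.
      by rewrite !(subsetP sub).
    by rewrite ui' wi'.
  have := cycle_iota_succ N; rewrite -val_enum_ord cycle_map; apply: sub_cycle.
  move=> i j /= /eqP ij; have -> : j = nx i by apply: val_inj.
  exact: bigS.
- by move=> i; rewrite mem_enum.
Qed.
End Strips.

(** * Insertion of a point into a parallel class *)

(** Expands every vertex of a closed walk into a segment. Segments are nonempty, so the default [y]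
    in [last y (f b)] is immaterial. *)
Lemma cycle_flatten (T U : Type) (e : rel T) (e' : rel U) (f : T -> seq U) L :
  (forall b, 0 < size (f b)) ->
  (forall b b' y, e b b' -> path e' (last y (f b)) (f b')) ->
  cycle e L -> cycle e' (flatten (map f L)).
Proof.
move=> f_gt0 fP; have lastf b y z : last y (f b) = last z (f b).
  by case: (f b) (f_gt0 b).
have pathF b y s : path e b s -> path e' (last y (f b)) (flatten (map f s)).
  elim: s b => //= b' s IHs b /andP[ebb' ps].
  by rewrite cat_path (fP _ _ _ ebb') (lastf b' _ y) IHs.
case: L => //= b L /(pathF _); case defb: (f b) (f_gt0 b) => [//|x t] _.
move/(_ x); rewrite -cats1 map_cat flatten_cat /= cats0 defb => pL.
rewrite -/(cycle e' (_ :: _)) -cat_cons -rot_size_cat rot_cycle.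
by rewrite (cycle_path x) last_cat (_ : last _ (x :: t) = last x (x :: t)).
Qed.

Lemma leq_count_flatten (T U : eqType) (p : pred T) (q : pred U) (f : T -> seq U) L :
  {in L, forall b, p b -> has q (f b)} -> count p L <= count q (flatten (map f L)).
Proof.
elim: L => //= b L IHL pq; rewrite count_cat leq_add //; last first.
  by apply: IHL => b' b'L; apply: pq; rewrite inE b'L orbT.
by case pb: (p b) => //; rewrite -has_count pq ?mem_head.
Qed.

Section Insertion.

Variables (P : finType) (mark : pred (P * P * P)).
Implicit Types (b : P * P * P) (L : seq (P * P * P)).

(* In the dual cubic graph this replaces the vertex [b] by a triangle. *)
Definition subdivide b : seq (option P * option P * option P) :=
  let: (u, w, z) := b in
  if mark b then [:: (Some w, Some u, None); (Some u, None, Some z);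
                     (None, Some z, Some w)]
  else [:: (Some u, Some w, Some z)].

Definition insert_point L := flatten (map subdivide L).

(** The three pairs of a marked block go to one new block each, so old pairs keep their
    multiplicity, and the new point meets each point of the block twice. The order of the new
    triples keeps the entry and exit pairs. Each marked block adds two blocks, and
    [v * (v - 1) + 2 * v = (v + 1) * v]. *)
Lemma gray_strip_insert L : gray_strip L ->
  (forall u, exists2 b, b \in L & mark b && (u \in points b)) ->
  3 * count mark L = #|P| -> gray_strip (insert_point L).
Proof.
case=> cyc uL szL cov markP cntm; split.
- apply: cycle_flatten cyc => [[[u w] z]|[[u w] z] [[u' w'] z'] y] /=; first by case: ifP.
  rewrite /next_triple /= !xpair_eqE => /orP[]/andP[/eqP-> /eqP->];
    case: ifP => _; case: ifP => _ /=;
    by rewrite /next_triple /= !xpair_eqE !eqxx ?orbT.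
- apply/allP=> c /flattenP[s /mapP[b bL ->]]; have := allP uL b bL.
  case: b bL => [[u w] z] _; rewrite /= !inE !negb_or => /and3P[/andP[uw uz] wz _].
  have opE (x y : P) : (Some x == Some y) = (x == y) by [].
  case: ifP => _; rewrite !inE; last by move/eqP->; rewrite /= !opE uw uz wz.
  case/or3P=> /eqP->; rewrite /= ?opE ?[w == u]eq_sym ?[z == w]eq_sym ?uw ?uz ?wz //.
- have -> : size (insert_point L) = size L + 2 * count mark L.
    rewrite /insert_point; elim: (L) => //= b L' IH; rewrite size_cat IH.
    by case: b => [[u w] z]; rewrite /subdivide; case: ifP => _ /=; lia.
  rewrite card_option /= mulnDr mulnCA szL cntm.
  by case: #|P| => // v; rewrite /=; ring.
- move=> [u|] [w|] //; rewrite -?[Some _ == Some _]/(_ == _) => neq.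
  + apply: leq_trans (cov u w neq) _; apply: leq_count_flatten.
    move=> [[x y] z] _; rewrite /covers /subdivide !inE /=.
    case: ifP => _ /andP[]; last first.
      by rewrite /covers /= !inE -![Some _ == Some _]/(_ == _) => -> ->.
    case/or3P=> /eqP hu /or3P[]/eqP hw; move: neq; rewrite ?hu ?hw ?eqxx // => _;
    by rewrite /covers /= !inE !eqxx ?orbT.
  + have [b bL /andP[mb ub]] := markP u; rewrite /insert_point.
    case/splitPr: bL => s1 s2; rewrite map_cat flatten_cat /= !count_cat.
    apply: leq_trans (leq_addl _ _); apply: leq_trans (leq_addr _ _).
    case: b mb ub => [[x y] z] mb; rewrite /subdivide mb /covers /points /= !inE /=.
    by case/or3P=> /eqP->; rewrite !eqxx ?orbT /=; lia.
  + have [b bL /andP[mb ub]] := markP w; rewrite /insert_point.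
    case/splitPr: bL => s1 s2; rewrite map_cat flatten_cat /= !count_cat.
    apply: leq_trans (leq_addl _ _); apply: leq_trans (leq_addr _ _).
    case: b mb ub => [[x y] z] mb; rewrite /subdivide mb /covers /points /= !inE /=.
    by case/or3P=> /eqP->; rewrite !eqxx ?orbT /=; lia.
Qed.

End Insertion.

(** * Necessary conditions *)

(** Incidences between 2-subsets and blocks are counted twice: two blocks per pair, three pairs per
    block. *)
Lemma TTS_card_blocks v (S : TTS v) : 3 * #|block_index S| = v * v.-1.
Proof.
have sum2 : \sum_(A : {set point S} | #|A| == 2)
    #|[set i : block_index S | A \subset block i]| = 'C(v, 2) * 2.
  rewrite (eq_bigr (fun=> 2)) => [|A /eqP]; last exact: pair_in_two_blocks.
  by rewrite sum_nat_cond_const card_draws card_point.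
have -> : v * v.-1 = v ^_ 2 by rewrite !ffactnS ffactn0 muln1.
rewrite -bin_ffact -[2`!]/2 -sum2.
under eq_bigr do rewrite -sum1dep_card big_mkcond.
rewrite exchange_big /= (eq_bigr (fun=> 3)) => [|i _].
  by rewrite sum_nat_const cardT -cardE mulnC.
rewrite -big_mkcondr sum1dep_card -[3]/('C(3, 2)) -(card_block i) -cards_draws.
by apply: eq_card => A; rewrite !inE andbC.
Qed.

Lemma hamiltonian_card (T : finType) (e : rel T) : hamiltonian e -> 3 <= #|T|.
Proof.
case=> c [sz3 /andP[_ uc] cT]; apply: leq_trans sz3 _.
by rewrite -(card_uniqP uc) max_card.
Qed.

(* Subsets of a 6-point set are bit sequences; walks grow at the front, and the
   two blocks chosen first are [{1, 2, 3}] and [{0, 1, 2}] up to relabelling. *)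
Definition bits6 : seq bitseq :=
  iter 6 (fun l => map (cons false) l ++ map (cons true) l) [:: [::]].

Lemma mem_bits6 s : size s = 6 -> s \in bits6.
Proof.
by case: s => [|[] [|[] [|[] [|[] [|[] [|[] []]]]]]].
Qed.

Definition meet2 (s t : bitseq) : bool :=
  count (fun p => p.1 && p.2) (zip s t) == 2.

Definition pair_count (l : seq bitseq) j k : nat :=
  count (fun s => nth false s j && nth false s k) l.

(** Nested conditionals instead of conjunctions let the evaluation stop at the first failing
    test. *)
Definition may_prepend (s : bitseq) (l : seq bitseq) : bool :=
  if meet2 s (head [::] l) then
    all (fun j => if nth false s j then
      all (fun k => if nth false s k then (j < k) ==> (pair_count l j k <= 1)
                    else true) (iota 0 6) else true) (iota 0 6)
  else false.

Definition subsets3 : seq bitseq := [seq s <- bits6 | count id s == 3].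

Definition first_blocks : seq bitseq :=
  [:: [:: false; true; true; true; false; false];
      [:: true; true; true; false; false; false]].

Fixpoint walks6 n : seq (seq bitseq) :=
  if n is n'.+1 then
    flatten [seq [seq s :: l | s <- subsets3 & may_prepend s l] | l <- walks6 n']
  else [:: first_blocks].

(** A TTS(6) has [6 * 5 / 3 = 10] blocks: the two fixed ones and eight prepended ones. *)
Lemma no_closed_walk6 :
  all (fun l => ~~ meet2 (last [::] l) (head [::] l)) (walks6 8).
Proof. vm_cast_no_check (erefl true). Qed.

(** The search is exhaustive: the bound on pair multiplicities passes to suffixes, so the pruning
    never discards part of an admissible walk. *)
Lemma mem_walks6 l : path meet2 (head [::] (l ++ first_blocks)) (behead (l ++ first_blocks)) ->
  {subset l <= subsets3} ->
  (forall j k, j != k -> pair_count (l ++ first_blocks) j k <= 2) ->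
  l ++ first_blocks \in walks6 (size l).
Proof.
elim: l => // s l IHl; have: l ++ first_blocks != [::] by case: (l).
rewrite cat_cons; set l' := l ++ _ in IHl *.
case defl' : l' => [//|t l''] _.
rewrite -defl' => psl sub le2; have /andP[st pl] : meet2 s t && path meet2 t l''.
  by move: psl; rewrite defl'.
rewrite [walks6 _]/(flatten [seq _ | l <- walks6 (size l)]).
apply/flatten_mapP; exists l'.
  apply: IHl; first by rewrite defl'.
    by move=> x xl; apply: sub; rewrite inE xl orbT.
  by move=> j k /le2; apply: leq_trans; rewrite /pair_count [in X in _ <= X]/= leq_addl.
apply: map_f; rewrite mem_filter sub ?mem_head // andbT /may_prepend {1}defl' st.
apply/allP=> j _; case: ifP => // js; apply/allP => k _; case: ifP => // ks.
apply/implyP; rewrite ltn_neqAle => /andP[/le2 le2jk _].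
by rewrite {1}/pair_count [count _ _]/= js ks ltnS in le2jk.
Qed.

Lemma no_hamiltonian_TTS6 (S : TTS 6) : ~ hamiltonian (two_BIG S).
Proof.
case=> c [sz3 /andP[cyc uc] cT].
have sz10 : size c = 10.
  have := TTS_card_blocks S; rewrite -(card_uniqP uc).
  have -> : #|c| = #|block_index S| by apply: eq_card => i; rewrite inE cT.
  by lia.
case/lastP: c sz3 cyc uc cT sz10 => // c i0 sz3 cyc uc cT sz10.
case/lastP: c sz3 cyc uc cT sz10 => // c i1 sz3 cyc uc cT sz10.
have i10 : two_BIG S i1 i0.
  case: c {sz3 uc cT sz10} cyc => [|i c]; first by case/andP.
  by rewrite -!cats1 [cycle _ _]/= -!cats1 -!catA cat_path => /andP[_ /and3P[]].
set A := block i0; set B := block i1.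
have AB2 : #|B :&: A| = 2 by apply/eqP.
(* Listing the points in this order, with parts of sizes 1, 2, 1, 2, gives [A] and [B] the codes in
   [first_blocks]. *)
pose pts := enum (A :\: B) ++ enum (B :&: A) ++ enum (B :\: A) ++ enum (~: (A :|: B)).
have ptsE x : count_mem x pts = 1.
  rewrite !count_cat !count_uniq_mem ?enum_uniq // !mem_enum !inE.
  by case: (x \in A); case: (x \in B).
have memp x : x \in pts by rewrite -has_pred1 has_count ptsE.
have upts : uniq pts by apply: count_mem_uniq => x; rewrite ptsE memp.
have countp (D : {set point S}) : count (mem D) pts = #|D|.
  rewrite -size_filter cardE; apply: perm_size; apply: uniq_perm.
  - exact: filter_uniq.
  - exact: enum_uniq.
  by move=> x; rewrite mem_filter memp andbT mem_enum.
have szpts : size pts = 6.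
  transitivity #|[set: point S]|; last by rewrite cardsT card_point.
  rewrite -countp; apply/esym/eqP; rewrite -all_count.
  by apply/allP=> x _; rewrite /= inE.
pose code i := [seq x \in block i | x <- pts].
have code3 i : code i \in subsets3.
  rewrite mem_filter count_map (countp (block i)) card_block.
  by apply: mem_bits6; rewrite size_map.
have meetE i j : two_BIG S i j -> meet2 (code i) (code j).
  rewrite /two_BIG /meet2 -countp => /eqP <-; apply/eqP.
  by rewrite /code; elim: (pts) => //= x s ->; rewrite in_setI.
have mapE (D : {set point S}) (E : {set point S}) d : (forall x, x \in E -> (x \in D) = d) ->
    [seq x \in D | x <- enum E] = nseq #|E| d.
  move=> ED; rewrite cardE -(size_map (fun x => x \in D)); apply/all_pred1P.
  by apply/allP=> _ /mapP[x + ->]; rewrite mem_enum => /ED /= ->.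
have [cA cB] : code i0 = nth [::] first_blocks 1 /\ code i1 = nth [::] first_blocks 0.
  have A3 : #|A| = 3 by exact: card_block.
  have B3 : #|B| = 3 by exact: card_block.
  have c1 : #|A :\: B| = 1 by have := cardsID B A; rewrite setIC AB2 A3; lia.
  have c2 : #|B :\: A| = 1 by have := cardsID A B; rewrite AB2 B3; lia.
  have c3 : #|~: (A :|: B)| = 2.
    have := cardsC (A :|: B); rewrite card_point.
    by have := cardsUI A B; rewrite [A :&: B]setIC AB2 A3 B3; lia.
  split; rewrite /code !map_cat.
    rewrite (mapE A _ true) 1?(mapE A (B :&: A) true) 1?(mapE A _ false) 1?(mapE A (~: _) false) ?c1 ?AB2 ?c2 ?c3 //;
    by move=> x; rewrite !inE; case: (x \in A); case: (x \in B).
  rewrite (mapE B _ false) 1?(mapE B (B :&: A) true) 1?(mapE B _ true) 1?(mapE B (~: _) false) ?c1 ?AB2 ?c2 ?c3 //;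
  by move=> x; rewrite !inE; case: (x \in A); case: (x \in B).
pose l := map code c.
have lE : map code (rcons (rcons c i1) i0) = l ++ first_blocks.
  by rewrite -!cats1 !map_cat -catA /= cA cB.
have cycl : cycle meet2 (l ++ first_blocks).
  by rewrite -lE cycle_map; apply: sub_cycle cyc => i j /meetE.
suff lw : l ++ first_blocks \in walks6 (size l).
  have sz8 : size l = 8 by move: sz10; rewrite !size_rcons size_map => -[].
  rewrite sz8 in lw; have /negP[] := allP no_closed_walk6 _ lw.
  case: (l) cycl => [|s l']; first by case/and3P.
  by rewrite [cycle _ _]/= rcons_path => /andP[_].
apply: mem_walks6.
- by case: (l) cycl => [|s l'] //; rewrite [cycle _ _]/= rcons_path => /andP[].
- by move=> s /mapP[i _ ->].
move=> j k neq_jk; rewrite -lE /pair_count.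
have [x0 _] : exists x0, x0 \in A by apply/card_gt0P; rewrite card_block.
(* Positions beyond the six points read the default [false], so pairs of indices out of range have
   count zero. *)
have nthE i m : nth false (code i) m = (m < 6) && (nth x0 pts m \in block i).
  case: ltnP => m6; first by rewrite (nth_map x0) ?szpts.
  by rewrite nth_default // size_map szpts.
rewrite count_map; case: (boolP ((j < 6) && (k < 6))) => [/andP[j6 k6]|out]; last first.
  rewrite (eq_count (a2 := pred0)) ?count_pred0 // => i /=; rewrite !nthE.
  by move: out; case: (j < 6) => //=; case: (k < 6) => //= _; rewrite andbF.
have neq : nth x0 pts j != nth x0 pts k by rewrite nth_uniq ?szpts.
have := pair_in_two_blocks (P := [set nth x0 pts j; nth x0 pts k]).
rewrite cards2 neq => /(_ erefl) two; rewrite -[X in _ <= X]two.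
rewrite -size_filter -(card_uniqP (filter_uniq _ uc)).
apply: subset_leq_card; apply/subsetP => i; rewrite mem_filter /= => /andP[+ _].
by rewrite !nthE !inE subUset !sub1set => /andP[/andP[_ ->] /andP[_ ->]].
Qed.

Lemma TTS_mod3 v (S : TTS v) : v = 0 %[mod 3] \/ v = 1 %[mod 3].
Proof.
have := TTS_card_blocks S; set N := #|_|; move: N => N eqN.
have : 3 %| v * v.-1 by rewrite -eqN dvdn_mulr.
by rewrite Euclid_dvdM // => /orP[]; lia.
Qed.

Lemma hamiltonian_TTS_order v (S : TTS v) : 3 <= v -> hamiltonian (two_BIG S) ->
  (v = 0 %[mod 3] \/ v = 1 %[mod 3]) /\ v \notin [:: 3; 6].
Proof.
move=> v3 hamS; split; first exact: (TTS_mod3 S).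
rewrite !inE negb_or; apply/andP; split; apply/eqP => eqv; subst v.
  by have := TTS_card_blocks S; have := hamiltonian_card hamS; lia.
exact: (@no_hamiltonian_TTS6 S).
Qed.

(** * Small orders *)

Lemma gray_strip_size (P : finType) (L : seq (P * P * P)) :
  3 < #|P| -> gray_strip L -> 3 <= size L.
Proof.
by move=> P4 [_ _ + _]; case: #|P| P4 => // v v3 /=; nia.
Qed.

(** The marked triples cover all points and number a third of them, hence they partition the point
    set. *)
Definition parallel_strip (P : finType) : Prop :=
  exists (L : seq (P * P * P)) (mark : pred (P * P * P)),
  [/\ gray_strip L,
      forall u, exists2 b, b \in L & mark b && (u \in points b) &
      3 * count mark L = #|P|].

Lemma parallel_strip_hamiltonian (P : finType) : 3 < #|P| -> parallel_strip P ->
  (exists S : TTS #|P|, hamiltonian (two_BIG S)) /\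
  (exists S : TTS #|P|.+1, hamiltonian (two_BIG S)).
Proof.
move=> P4 [L [mark [gL markP cntm]]]; split.
  exact: gray_strip_hamiltonian (gray_strip_size P4 gL) gL.
have gL' := gray_strip_insert gL markP cntm; rewrite -card_option.
apply: gray_strip_hamiltonian (gray_strip_size _ gL') gL'.
by rewrite card_option ltnW.
Qed.

(** Boolean counterpart of [gray_strip] on the points below [v], to be decided by computation. *)
Definition nat_strip v (l : seq (nat * nat * nat)) : bool :=
  [&& cycle next_triple l,
      all (fun b => uniq (points b) && all (fun x => x < v) (points b)) l,
      3 * size l == v * v.-1 &
      all (fun j => all (fun k => (j == k) || (1 < count (covers j k) l)) (iota 0 v))
          (iota 0 v)].

Section NatStrip.

Variables (v : nat) (l : seq (nat * nat * nat)).
Hypothesis stripl : nat_strip v.+1 l.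

Let ord3 (b : nat * nat * nat) : 'I_v.+1 * 'I_v.+1 * 'I_v.+1 :=
  (inord b.1.1, inord b.1.2, inord b.2).

Lemma points_ord3 b : points (ord3 b) = map inord (points b).
Proof. by []. Qed.

Lemma mem_points_ord3 b (u : 'I_v.+1) : b \in l ->
  (u \in points (ord3 b)) = (val u \in points b).
Proof.
move=> bl; have /and4P[_ /allP/(_ _ bl)/andP[_ /allP lev] _ _] := stripl.
rewrite points_ord3; apply/mapP/idP => [[k kb ->]|ub]; first by rewrite /= inordK ?lev.
by exists (val u); rewrite // inord_val.
Qed.

Lemma nat_strip_gray : gray_strip (map ord3 l).
Proof.
have /and4P[cyc /allP all3 /eqP szl /allP cov] := stripl; split.
- rewrite cycle_map; apply: sub_cycle cyc => [[[u w] z] [[u' w'] z']].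
  by rewrite /next_triple /= !xpair_eqE => /orP[]/andP[/eqP-> /eqP->]; rewrite !eqxx ?orbT.
- apply/allP=> _ /mapP[b /all3 /andP[ub /allP lev] ->]; rewrite points_ord3.
  rewrite map_inj_in_uniq // => j k /lev jv /lev kv /(congr1 val).
  by rewrite /= !inordK.
- by rewrite size_map card_ord.
move=> u w neq_uw.
have memI (x : 'I_v.+1) : val x \in iota 0 v.+1 by rewrite mem_iota ltn_ord.
have /allP/(_ _ (memI w)) := cov _ (memI u).
rewrite val_eqE (negbTE neq_uw) count_map => /leq_trans; apply.
rewrite (@eq_in_count _ (covers (val u) (val w)) (preim ord3 (covers u w))) //.
by move=> b bl; rewrite /= /covers !mem_points_ord3.
Qed.

(** The explicit lists of order divisible by 3 are labelled so that their parallel class consists of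
    the triples [{3i, 3i + 1, 3i + 2}]. *)
Definition same_row (b : nat * nat * nat) : bool :=
  (b.1.1 %/ 3 == b.1.2 %/ 3) && (b.1.2 %/ 3 == b.2 %/ 3).

Lemma nat_strip_parallel : 3 * count same_row l = v.+1 ->
  all (fun k => has (fun b => same_row b && (k \in points b)) l) (iota 0 v.+1) ->
  parallel_strip 'I_v.+1.
Proof.
move=> cntl /allP rows.
pose mark (b : 'I_v.+1 * 'I_v.+1 * 'I_v.+1) :=
  same_row (val b.1.1, val b.1.2, val b.2).
have markE b : b \in l -> mark (ord3 b) = same_row b.
  move=> bl; have /and4P[_ /allP/(_ _ bl)/andP[_]] := stripl.
  by rewrite /= andbT => /and3P[? ? ?] _ _; rewrite /mark /= !inordK.
exists (map ord3 l), mark; split; first exact: nat_strip_gray.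
  move=> u; have uI : val u \in iota 0 v.+1 by rewrite mem_iota ltn_ord.
  have /hasP[b bl /andP[rb ub]] := rows _ uI.
  by exists (ord3 b); rewrite ?map_f // markE // rb mem_points_ord3.
by rewrite count_map (eq_in_count (a2 := same_row)) ?cntl ?card_ord.
Qed.

End NatStrip.

(** Orders 4 and 7 are listed directly, being the successors of the excluded orders 3 and 6. *)
Definition strip4 : seq (nat * nat * nat) :=
  [:: (2,3,0); (3,0,1); (0,1,2); (1,2,3)].

Definition strip7 : seq (nat * nat * nat) :=
  [:: (5,4,6); (6,4,3); (3,4,0); (4,0,2); (0,2,6); (6,2,5); (2,5,3); (3,5,0);
      (5,0,1); (0,1,6); (6,1,3); (3,1,2); (2,1,4); (1,4,5)].

(** From here on the lists treat the orders [3n + 3] with [2 <= n <= 6], below the range of the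
    general family. *)
Definition strip9 : seq (nat * nat * nat) :=
  [:: (5,0,8); (8,0,3); (3,0,6); (0,6,4); (4,6,5); (6,5,1); (5,1,8); (1,8,6);
      (6,8,7); (8,7,4); (4,7,0); (0,7,1); (7,1,3); (1,3,4); (4,3,5); (3,5,7);
      (5,7,2); (7,2,6); (6,2,3); (3,2,8); (8,2,4); (4,2,1); (1,2,0); (2,0,5)].

Definition strip12 : seq (nat * nat * nat) :=
  [:: (3,7,2); (7,2,4); (2,4,11); (4,11,3); (11,3,8); (3,8,1); (8,1,5);
      (5,1,2); (2,1,0); (0,1,4); (4,1,7); (1,7,10); (7,10,0); (0,10,4);
      (10,4,8); (8,4,9); (4,9,6); (9,6,7); (6,7,8); (8,7,11); (11,7,5);
      (7,5,9); (5,9,2); (2,9,0); (9,0,8); (8,0,5); (5,0,11); (0,11,6);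
      (11,6,1); (1,6,10); (10,6,5); (6,5,4); (4,5,3); (5,3,10); (10,3,9);
      (3,9,1); (1,9,11); (9,11,10); (11,10,2); (10,2,8); (8,2,6); (2,6,3);
      (6,3,0); (0,3,7)].

Definition strip15 : seq (nat * nat * nat) :=
  [:: (13,1,6); (1,6,3); (6,3,9); (3,9,12); (12,9,4); (4,9,8); (9,8,0);
      (8,0,3); (0,3,14); (14,3,11); (3,11,7); (7,11,6); (11,6,4); (6,4,2);
      (2,4,14); (4,14,5); (14,5,8); (5,8,11); (11,8,1); (8,1,14); (14,1,12);
      (1,12,11); (12,11,2); (11,2,5); (2,5,12); (12,5,6); (6,5,9); (5,9,1);
      (9,1,7); (7,1,4); (1,4,3); (4,3,5); (3,5,10); (5,10,7); (7,10,4);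
      (4,10,12); (10,12,8); (12,8,7); (7,8,6); (6,8,2); (8,2,3); (3,2,10);
      (2,10,1); (10,1,0); (1,0,2); (0,2,9); (2,9,13); (9,13,11); (11,13,14);
      (14,13,12); (12,13,3); (3,13,7); (13,7,2); (2,7,14); (7,14,9); (14,9,10);
      (9,10,11); (10,11,0); (11,0,4); (0,4,13); (4,13,8); (8,13,10); (13,10,6);
      (10,6,14); (14,6,0); (6,0,12); (12,0,7); (7,0,5); (0,5,13); (5,13,1)].

Definition strip18 : seq (nat * nat * nat) :=
  [:: (10,6,5); (6,5,14); (5,14,4); (4,14,17); (14,17,3); (17,3,4); (4,3,5);
      (5,3,15); (3,15,14); (15,14,13); (14,13,12); (12,13,16); (16,13,3);
      (13,3,11); (3,11,6); (6,11,14); (14,11,10); (10,11,9); (9,11,1);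
      (11,1,5); (1,5,9); (9,5,8); (5,8,13); (8,13,2); (2,13,7); (13,7,4);
      (7,4,9); (4,9,2); (9,2,12); (12,2,3); (3,2,16); (16,2,11); (2,11,7);
      (11,7,5); (7,5,17); (17,5,2); (5,2,15); (15,2,6); (6,2,0); (0,2,1);
      (2,1,17); (17,1,13); (1,13,10); (10,13,9); (13,9,15); (15,9,6); (9,6,12);
      (12,6,8); (6,8,7); (7,8,15); (8,15,1); (1,15,12); (15,12,11); (11,12,17);
      (12,17,8); (17,8,11); (8,11,0); (11,0,13); (13,0,5); (0,5,16); (16,5,12);
      (5,12,10); (10,12,0); (0,12,4); (12,4,1); (1,4,6); (4,6,13); (13,6,17);
      (6,17,0); (17,0,9); (9,0,14); (0,14,8); (8,14,2); (14,2,10); (2,10,4);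
      (4,10,8); (10,8,16); (8,16,4); (16,4,11); (11,4,15); (4,15,0); (15,0,7);
      (0,7,16); (7,16,6); (6,16,1); (1,16,14); (14,16,9); (9,16,17);
      (17,16,15); (16,15,10); (15,10,17); (17,10,7); (10,7,1); (1,7,14);
      (14,7,12); (12,7,3); (7,3,9); (9,3,8); (8,3,1); (1,3,0); (0,3,10);
      (3,10,6)].

Definition strip21 : seq (nat * nat * nat) :=
  [:: (5,18,11); (11,18,9); (18,9,15); (9,15,3); (15,3,1); (3,1,0); (1,0,2);
      (0,2,7); (2,7,11); (7,11,0); (11,0,14); (0,14,4); (4,14,8); (8,14,9);
      (9,14,6); (14,6,20); (20,6,18); (18,6,15); (6,15,19); (19,15,4);
      (4,15,20); (20,15,0); (15,0,10); (0,10,12); (10,12,4); (4,12,6);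
      (6,12,8); (12,8,13); (8,13,19); (13,19,9); (9,19,17); (19,17,6);
      (17,6,0); (0,6,13); (13,6,10); (10,6,1); (6,1,11); (1,11,12); (11,12,19);
      (12,19,0); (0,19,3); (19,3,11); (11,3,14); (3,14,13); (13,14,12);
      (14,12,16); (16,12,20); (12,20,7); (20,7,1); (1,7,15); (15,7,13);
      (7,13,5); (5,13,11); (13,11,15); (15,11,17); (11,17,2); (17,2,9);
      (2,9,16); (9,16,6); (6,16,11); (16,11,8); (8,11,4); (4,11,20);
      (20,11,10); (11,10,9); (10,9,1); (1,9,12); (12,9,7); (7,9,5); (5,9,4);
      (9,4,3); (4,3,5); (5,3,6); (3,6,7); (6,7,8); (8,7,19); (19,7,14);
      (14,7,18); (7,18,4); (4,18,10); (18,10,14); (10,14,15); (14,15,16);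
      (15,16,17); (16,17,18); (18,17,1); (1,17,4); (17,4,13); (4,13,1);
      (1,13,16); (16,13,2); (13,2,10); (10,2,3); (2,3,20); (20,3,16); (16,3,8);
      (3,8,10); (10,8,17); (17,8,0); (8,0,9); (0,9,20); (9,20,13); (13,20,17);
      (20,17,14); (14,17,5); (17,5,12); (12,5,15); (5,15,8); (8,15,2);
      (15,2,12); (12,2,18); (2,18,8); (18,8,1); (1,8,20); (8,20,5); (20,5,10);
      (5,10,19); (10,19,16); (16,19,18); (18,19,20); (20,19,2); (19,2,4);
      (4,2,6); (6,2,5); (5,2,14); (2,14,1); (14,1,19); (19,1,5); (1,5,16);
      (5,16,0); (0,16,4); (4,16,7); (16,7,10); (10,7,17); (7,17,3); (17,3,12);
      (12,3,18); (3,18,13); (13,18,0); (0,18,5)].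

Lemma hamiltonian_TTS4 : exists S : TTS 4, hamiltonian (two_BIG S).
Proof.
have /nat_strip_gray gL : nat_strip 4 strip4 by vm_compute.
by have := gray_strip_hamiltonian _ gL; rewrite size_map card_ord; apply.
Qed.

Lemma hamiltonian_TTS7 : exists S : TTS 7, hamiltonian (two_BIG S).
Proof.
have /nat_strip_gray gL : nat_strip 7 strip7 by vm_compute.
by have := gray_strip_hamiltonian _ gL; rewrite size_map card_ord; apply.
Qed.

Lemma parallel_strip9 : parallel_strip 'I_9.
Proof. by apply: (@nat_strip_parallel 8 strip9); vm_compute. Qed.

Lemma parallel_strip12 : parallel_strip 'I_12.
Proof. by apply: (@nat_strip_parallel 11 strip12); vm_compute. Qed.

Lemma parallel_strip15 : parallel_strip 'I_15.
Proof. by apply: (@nat_strip_parallel 14 strip15); vm_compute. Qed.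

Lemma parallel_strip18 : parallel_strip 'I_18.
Proof. by apply: (@nat_strip_parallel 17 strip18); vm_compute. Qed.

Lemma parallel_strip21 : parallel_strip 'I_21.
Proof. by apply: (@nat_strip_parallel 20 strip21); vm_compute. Qed.

(** * Walks and the Pasch trade *)

Section Walks.

Variable T : eqType.
Implicit Types (p q r : T * T) (b : T * T * T) (L : seq (T * T * T)).

Definition same_pair p q : bool := (p == q) || (p == (q.2, q.1)).

Definition exit b : T * T := (b.1.2, b.2).

(** Keeps track of the entry and exit pairs up to order, so that pieces can be concatenated, cut and
    reversed, unlike with [cycle next_triple]. *)
Fixpoint walk p L q : bool :=
  if L is b :: L' then same_pair b.1 p && walk (exit b) L' q else same_pair p q.

Definition flip b : T * T * T := (b.2, b.1.2, b.1.1).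

Lemma same_pair_sym : symmetric same_pair.
Proof.
by move=> [u w] [x y]; rewrite /same_pair !xpair_eqE ![x == _]eq_sym ![y == _]eq_sym [X in _ || X]andbC.
Qed.

Lemma same_pair_trans : transitive same_pair.
Proof.
move=> [u w] [x y] [x' y']; rewrite /same_pair !xpair_eqE /=.
by move=> /orP[]/andP[/eqP-> /eqP->] /orP[]/andP[/eqP-> /eqP->]; rewrite !eqxx ?orbT.
Qed.

Lemma walk_same p p' L q : same_pair p p' -> walk p' L q -> walk p L q.
Proof.
case: L => [|b L] /= pp'; first exact: same_pair_trans.
case/andP=> bp' ->; rewrite andbT; apply: same_pair_trans bp' _.
by rewrite same_pair_sym.
Qed.

Lemma walk_nil p : walk p [::] p.
Proof. by rewrite /= /same_pair eqxx. Qed.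

Lemma walk_nil_swap u w : walk (u, w) [::] (w, u).
Proof. by rewrite /= /same_pair eqxx orbT. Qed.

Lemma walk_cons u w z L q : walk (w, z) L q -> walk (u, w) ((u, w, z) :: L) q.
Proof. by move=> wL; rewrite /= /same_pair eqxx. Qed.

Lemma walk_cons_swap u w z L q : walk (w, z) L q -> walk (w, u) ((u, w, z) :: L) q.
Proof. by move=> wL; rewrite /= /same_pair eqxx orbT. Qed.

Lemma cat_walk p L q L' r : walk p L q -> walk q L' r -> walk p (L ++ L') r.
Proof.
elim: L p => [|b L IHL] p /=; first exact: walk_same.
by case/andP=> -> /IHL.
Qed.

Lemma walk_split p L b L' q : walk p (L ++ b :: L') q ->
  walk p L b.1 /\ walk (exit b) L' q.
Proof.
elim: L p => [|c L IHL] p /=; first by rewrite same_pair_sym => /andP[].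
by case/andP=> -> /IHL.
Qed.

Lemma walk_rev p L q : walk p L q -> walk q (map flip (rev L)) p.
Proof.
elim: L p => [|[[u w] z] L IHL] p /=; first by rewrite same_pair_sym.
case/andP=> bp /IHL {}IHL; rewrite rev_cons map_rcons -cats1.
apply: (cat_walk IHL); rewrite /= /flip /exit /same_pair /= !eqxx orbT /=.
apply: same_pair_trans bp; by rewrite /same_pair !eqxx orbT.
Qed.

Lemma walk_cycle p L : walk p L p -> cycle next_triple L.
Proof.
case: L => // b0 L /= /andP[b0p]; elim: L {1 2}b0 => [|c L IHL] b /=.
  rewrite same_pair_sym andbT => pb; exact: (same_pair_trans b0p pb).
by case/andP=> cb /IHL->; rewrite andbT.
Qed.

(* The Pasch trade [A x y, B x z, C y z, A B C -> x y z, A B x, A C y, B C z]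
   opens the closed walk at three blocks; the second copy of [A B C] is the
   block [(B, A, C)]. The resulting pieces close up to a single walk whichever
   of [B x z] and [C y z] comes first. *)
Lemma pasch_walk (A B C x y z : T) L :
  walk (x, A) ((x, A, y) :: L) (x, A) ->
  (B, z, x) \in L -> (C, z, y) \in L -> B != C ->
  exists2 L', cycle next_triple L' & forall pr : pred (T * T * T), (forall b, pr (flip b) = pr b) ->
    count pr L' + pr (B, z, x) + pr (C, z, y) =
    count pr L + count pr [:: (x, A, B); (B, A, C); (C, A, y); (B, z, C); (x, z, y)].
Proof.
move=> /andP[_ wL] BL CL neqBC.
have countE (pr : pred (T * T * T)) s : (forall b, pr (flip b) = pr b) ->
    count pr (map flip (rev s)) = count pr s.
  by move=> prE; rewrite count_map (eq_count prE) count_rev.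
have [[S1 [S2 [S3 defL]]] | [S1 [S2 [S3 defL]]]] :
    (exists S1 S2 S3, L = S1 ++ (B, z, x) :: S2 ++ (C, z, y) :: S3) \/
    (exists S1 S2 S3, L = S1 ++ (C, z, y) :: S2 ++ (B, z, x) :: S3).
  case/splitPr: BL CL => s1 s2; rewrite mem_cat inE !xpair_eqE eq_sym (negbTE neqBC) /=.
  case/orP=> /splitPr[s3 s4].
    by right; exists s3, s4, s2; rewrite -catA.
  by left; exists s1, s3, s4.
- move: wL; rewrite defL => /walk_split[w1 /walk_split[w2 w3]].
  (* The segment between the two removed blocks is traversed backwards: [(B, z, C)] leads to its far
     end [{C, z}], and [(x, z, y)] leads from its near end [{z, x}] on to [S3]. *)
  exists ([:: (x, A, B); (B, A, C); (C, A, y)] ++ S1 ++ (B, z, C) :: map flip (rev S2) ++ (x, z, y) :: S3).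
    apply: (@walk_cycle (x, A)); rewrite /= /exit /same_pair /= !eqxx ?orbT /=.
    apply: (cat_walk (q := (B, z)) w1); rewrite /= /same_pair eqxx /=.
    apply: (cat_walk (q := (z, x))).
      by apply: walk_same (walk_rev w2); rewrite /same_pair /= eqxx orbT.
    by rewrite /= /same_pair /= !eqxx orbT; apply: walk_same w3; rewrite /same_pair /= eqxx.
  move=> pr prE; rewrite !count_cat /= !count_cat /= countE //; ring.
move: wL; rewrite defL => /walk_split[w1 /walk_split[w2 w3]].
exists ([:: (x, A, B); (B, A, C); (C, A, y)] ++ S1 ++ (C, z, B) :: map flip (rev S2) ++ (y, z, x) :: S3).
  apply: (@walk_cycle (x, A)); rewrite /= /exit /same_pair /= !eqxx ?orbT /=.
  apply: (cat_walk (q := (C, z)) w1); rewrite /= /same_pair eqxx /=.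
  apply: (cat_walk (q := (z, y))).
      by apply: walk_same (walk_rev w2); rewrite /same_pair /= eqxx orbT.
  by rewrite /= /same_pair /= !eqxx orbT; apply: walk_same w3; rewrite /same_pair /= eqxx.
move=> pr prE; rewrite !count_cat /= !count_cat /= countE //.
have := prE (B, z, C); have := prE (x, z, y); rewrite /flip /= => -> ->; ring.
Qed.

(** The trade loses no pair. A point matters only through its index in [s], where 6 stands for every
    other point, which leaves finitely many cases. *)
Lemma pasch_covers (A B C x y z u w : T) : uniq [:: A; B; C; x; y; z] -> u != w ->
  covers u w (x, A, y) + covers u w (B, z, x) + covers u w (C, z, y) <=
  count (covers u w) [:: (x, A, B); (B, A, C); (C, A, y); (B, z, C); (x, z, y)].
Proof.
set s := [:: A; B; C; x; y; z] => us neq_uw.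
have eqE v k : k < 6 -> (v == nth A s k) = (index v s == k).
  move=> k6; apply/eqP/eqP => [->|eqk]; first by rewrite index_uniq.
  by rewrite -eqk nth_index // -index_mem eqk.
(* Distinct points share an index only when both lie outside [s]. *)
have neq_ij : index u s = index w s -> index u s = 6.
  move=> eq_ij; case: (ltngtP (index u s) 6) => // [lt6|]; last by rewrite ltnNge index_size.
  by case/eqP: neq_uw; rewrite -(nth_index A (_ : u \in s)) ?eq_ij ?nth_index // -index_mem -?eq_ij.
rewrite /covers /points /= !inE.
have cE v : ((v == A) = (index v s == 0)) * ((v == B) = (index v s == 1)) *
    ((v == C) = (index v s == 2)) * ((v == x) = (index v s == 3)) *
    ((v == y) = (index v s == 4)) * ((v == z) = (index v s == 5)).
  by do !split; rewrite -eqE.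
rewrite !cE; move: (index u s) (index w s) neq_ij => i j.
case: i => [|[|[|[|[|[|i]]]]]]; case: j => [|[|[|[|[|[|j]]]]]] //=; by move/(_ erefl).
Qed.

End Walks.

(** * Translation-invariant strips *)

Import GRing.Theory.

Section Translates.

Local Open Scope ring_scope.

Variable m : nat.
Notation n := m.+2.
Notation G := 'I_m.+2.
Notation pt := (G * 'I_3 + 'I_3)%type.
Implicit Types (s x y d : G) (l : 'I_3) (b : pt * pt * pt).

Definition lv l x : pt := inl (x, l).
Definition hole l : pt := inr l.

Definition tr s (u : pt) : pt := if u is inl (x, l) then inl (x + s, l) else u.
Definition trb s b : pt * pt * pt := (tr s b.1.1, tr s b.1.2, tr s b.2).

Lemma tr_inj s : injective (tr s).
Proof.
move=> [[x l]|h] [[x' l']|h'] // /eqP; rewrite -[_ == _]/((_, _) == (_, _)) xpair_eqE.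
by rewrite (inj_eq (@addIr _ s)) => /andP[/eqP-> /eqP->].
Qed.

Lemma walk_tr s p L q : walk p L q ->
  walk (tr s p.1, tr s p.2) (map (trb s) L) (tr s q.1, tr s q.2).
Proof.
have same p' q' : same_pair p' q' -> same_pair (tr s p'.1, tr s p'.2) (tr s q'.1, tr s q'.2).
  by case: p' q' => [u w] [x y] /orP[]/eqP[-> ->]; rewrite /same_pair eqxx ?orbT.
elim: L p => [|b L IHL] p /=; first exact: same.
by case/andP=> /same bp /IHL ->; rewrite andbT.
Qed.

Definition rounds g (L : seq (pt * pt * pt)) k :=
  flatten [seq map (trb (g *+ j)) L | j <- iota 0 k].

Lemma natn0 : n%:R = 0 :> G.
Proof. by rewrite Zp_nat; apply: val_inj; rewrite /= modnn. Qed.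

Lemma trM s s' u : tr s (tr s' u) = tr (s' + s) u.
Proof. by case: u => [[x l]|h] //=; rewrite addrA. Qed.

Lemma tr0 u : tr 0 u = u.
Proof. by case: u => [[x l]|h] //=; rewrite addr0. Qed.

(** After [k] copies the walk has arrived at the translate of [p] by [g *+ k]; it closes up because
    [n] vanishes in [Z_n]. *)
Lemma walk_rounds g p L : walk p L (tr g p.1, tr g p.2) -> walk p (rounds g L n) p.
Proof.
move=> wL; suff wk k : walk p (rounds g L k) (tr (g *+ k) p.1, tr (g *+ k) p.2).
  by move: (wk n); rewrite -mulr_natr natn0 mulr0 !tr0 -surjective_pairing.
elim: k => [|k IHk]; first by rewrite mulr0n !tr0 /= /same_pair -surjective_pairing eqxx.
have iotaS : iota 0 k.+1 = iota 0 k ++ [:: k] by rewrite -[k.+1]addn1 iotaD.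
rewrite /rounds iotaS map_cat flatten_cat /= cats0.
apply: cat_walk IHk _; have := walk_tr (g *+ k) wL.
by rewrite !trM -mulrS.
Qed.

(** The copy for [j = 0] is untranslated, which puts a known block at the front, as [pasch_walk]
    requires. *)
Lemma rounds_cons g b L : exists L', rounds g (b :: L) n = b :: L'.
Proof.
by case: b => [[u w] z]; rewrite /rounds /= mulr0n /trb !tr0; eexists.
Qed.

Section Generator.

Variables (g c : G) (gc : c * g = 1) (L : seq (pt * pt * pt)).

(** Since [c * g = 1], the multiples of [g] run once through [Z_n], so counting over the rounds is
    counting all translates of each base block. *)
Lemma count_rounds (pr : pred (pt * pt * pt)) :
  count pr (rounds g L n) = (\sum_(b <- L) #|[set s | pr (trb s b)]|)%N.
Proof.
rewrite /rounds -sum1_count big_flatten big_map.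
under eq_bigr do rewrite big_map big_mkcond.
rewrite exchange_big; apply: eq_bigr => b _.
rewrite -sum1dep_card [RHS]big_mkcond -[iota 0 n]/(index_iota 0 n) big_mkord.
rewrite [RHS](reindex (fun k : G => g * k)).
  by apply: eq_bigr => k _; rewrite -mulr_natr natr_Zp.
by exists (fun s => c * s) => s _; rewrite mulrA 1?[g * c]mulrC gc mul1r.
Qed.

Lemma mem_rounds s b : b \in L -> trb s b \in rounds g L n.
Proof.
move=> bL; rewrite -has_pred1 has_count count_rounds.
rewrite (big_rem b) //= addn_gt0; apply/orP; left.
by apply/card_gt0P; exists s; rewrite inE /= eqxx.
Qed.

End Generator.

End Translates.

Arguments lv {m} l x%_R.

(** * Strands between two levels and the pairs covered by their orbits *)

Section Strands.

Local Open Scope ring_scope.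

Variable m : nat.
Notation n := m.+2.
Notation G := 'I_m.+2.
Notation pt := (G * 'I_3 + 'I_3)%type.
Implicit Types (s x y d : G) (l : 'I_3) (b : pt * pt * pt).

(** Summed over a strip whose translation is a generator, this is the multiplicity of the pair in
    the whole cycle, by [count_rounds]. *)
Definition occ (u w : pt) b : nat := #|[set s | covers u w (trb s b)]|.

Lemma occ_ge (u w : pt) b (r : seq G) : uniq r ->
  all (fun s => covers u w (trb s b)) r -> (size r <= occ u w b)%N.
Proof.
move=> ur /allP rP; rewrite -(card_uniqP ur); apply: subset_leq_card.
by apply/subsetP => s /rP; rewrite inE.
Qed.

Lemma mem_tr s u b : u \in points b -> tr s u \in points (trb s b).
Proof. exact: (map_f (tr s)). Qed.

Lemma covers_tr s u w u' w' b : tr s u = u' -> tr s w = w' ->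
  u \in points b -> w \in points b -> covers u' w' (trb s b).
Proof. by move=> <- <- ub wb; rewrite /covers !mem_tr. Qed.

Lemma occ_sym u w b : occ u w b = occ w u b.
Proof. by apply: eq_card => s; rewrite !inE /covers andbC. Qed.

Lemma occ_mixed l1 l2 p q y d b : lv l1 p \in points b -> lv l2 q \in points b ->
  ((d == q - p :> G)%R <= occ (lv l1 y) (lv l2 (y + d)%R) b)%N.
Proof.
move=> pb qb; case: eqP => // ->; apply: (@occ_ge _ _ _ [:: y - p]) => //=.
by rewrite andbT; apply: covers_tr pb qb; congr (inl (_, _)); ring.
Qed.

Lemma occ_hole l h p y b : lv l p \in points b -> hole m h \in points b ->
  (0 < occ (lv l y) (hole m h) b)%N.
Proof.
move=> pb hb; apply: (@occ_ge _ _ _ [:: y - p]) => //=.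
by rewrite andbT; apply: covers_tr pb hb => //; congr (inl (_, _)); ring.
Qed.

(** When [q - p] is its own negative both terms count: the translations by [y - p] and [y - q] are
    distinct and both cover the pair. *)
Lemma occ_pure l p q y d b : p != q -> lv l p \in points b -> lv l q \in points b ->
  ((d == q - p :> G)%R + (d == p - q :> G)%R <= occ (lv l y) (lv l (y + d)%R) b)%N.
Proof.
move=> neq_pq pb qb.
have cp : d = q - p -> covers (lv l y) (lv l (y + d)) (trb (y - p) b).
  by move=> ->; apply: covers_tr pb qb; congr (inl (_, _)); ring.
have cq : d = p - q -> covers (lv l y) (lv l (y + d)) (trb (y - q) b).
  by move=> ->; apply: covers_tr qb pb; congr (inl (_, _)); ring.
case: eqP => [/cp dp|_]; case: eqP => [/cq dq|_] //=.
- apply: (@occ_ge _ _ _ [:: y - p; y - q]) => /=; last by rewrite dp dq.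
  by rewrite inE andbT (inj_eq (addrI y)) (inj_eq oppr_inj).
- by apply: (@occ_ge _ _ _ [:: y - p]) => //=; rewrite dp.
- by apply: (@occ_ge _ _ _ [:: y - q]) => //=; rewrite dq.
Qed.

(* A strand passes through the mixed pairs [{x_l1, (x + d)_l2}] for successive
   differences [d]; its blocks contain a second point of level [l2], or of
   level [l1] if the flag [f] is set. *)
Definition sblk l1 l2 x d d' (f : bool) : pt * pt * pt :=
  if f then (lv l1 x, lv l2 (x + d), lv l1 (x + d - d'))
  else (lv l2 (x + d), lv l1 x, lv l2 (x + d')).

Definition nextx x d d' (f : bool) : G := if f then x + d - d' else x.

Fixpoint strand l1 l2 x d (ds : seq (G * bool)) : seq (pt * pt * pt) :=
  if ds is (d', f) :: ds' then
    sblk l1 l2 x d d' f :: strand l1 l2 (nextx x d d' f) d' ds'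
  else [::].

Fixpoint strand_end x d (ds : seq (G * bool)) : G :=
  if ds is (d', f) :: ds' then strand_end (nextx x d d' f) d' ds' else x.

Fixpoint steps d (ds : seq (G * bool)) : seq (G * G * bool) :=
  if ds is (d', f) :: ds' then (d, d', f) :: steps d' ds' else [::].

Lemma walk_strand l1 l2 x d ds :
  let x' := strand_end x d ds in
  walk (lv l1 x, lv l2 (x + d)) (strand l1 l2 x d ds)
       (lv l1 x', lv l2 (x' + last d (map fst ds))).
Proof.
elim: ds x d => [|[d' f] ds IHds] x d /=; first by rewrite /same_pair eqxx.
apply/andP; split; first by rewrite /sblk /same_pair; case: f; rewrite eqxx ?orbT.
apply: walk_same (IHds _ _); rewrite /exit /sblk /nextx /same_pair.
by case: f; rewrite /= ?subrK eqxx ?orbT.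
Qed.

Lemma strand_all (pr : pred (pt * pt * pt)) l1 l2 x d ds :
  (forall y e, e \in steps d ds -> pr (sblk l1 l2 y e.1.1 e.1.2 e.2)) ->
  all pr (strand l1 l2 x d ds).
Proof.
elim: ds x d => //= [[d' f] ds] IHds x d prP.
apply/andP; split; first by apply: (prP x (d, d', f)); rewrite mem_head.
by apply: IHds => y e eds; apply: prP; rewrite inE eds orbT.
Qed.

Lemma strand_sum (F : pt * pt * pt -> nat) (H : G * G * bool -> nat) l1 l2 x d ds :
  (forall y e, e \in steps d ds -> (H e <= F (sblk l1 l2 y e.1.1 e.1.2 e.2))%N) ->
  (\sum_(e <- steps d ds) H e <= \sum_(b <- strand l1 l2 x d ds) F b)%N.
Proof.
elim: ds x d => [|[d' f] ds IHds] x d HF /=; first by rewrite !big_nil.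
rewrite !big_cons leq_add //; first by apply: (HF x (d, d', f)); rewrite mem_head.
by apply: IHds => y e eds; apply: HF; rewrite inE eds orbT.
Qed.

(** An inner difference is met twice, on leaving one block and on entering the next. The first and
    the last difference are each met once less, whence the two corrections. *)
Lemma strand_mixed l1 l2 x d ds y (c : G) :
  (forall e, e \in steps d ds -> e.1.1 != e.1.2) ->
  (2 * count_mem c (d :: map fst ds) <=
   \sum_(b <- strand l1 l2 x d ds) occ (lv l1 y) (lv l2 (y + c)) b +
   (c == d) + (c == last d (map fst ds)))%N.
Proof.
elim: ds x d => [|[d' f] ds IHds] x d neq; first by rewrite big_nil /= eq_sym; lia.
have {IHds} IHds : (2 * count_mem c (d' :: map fst ds) <=
    \sum_(b <- strand l1 l2 (nextx x d d' f) d' ds) occ (lv l1 y) (lv l2 (y + c)) b +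
    (c == d') + (c == last d' (map fst ds)))%N.
  by apply: IHds => e eds; apply: neq; rewrite inE eds orbT.
have neq_d : d != d' by apply: (neq (d, d', f)); rewrite mem_head.
rewrite [strand _ _ _ _ _]/= big_cons [last _ _]/=.
have -> : count_mem c (d :: map fst ((d', f) :: ds)) =
  ((c == d) + count_mem c (d' :: map fst ds))%N by rewrite /= [d == c]eq_sym.
suff : ((c == d) + (c == d') <= occ (lv l1 y) (lv l2 (y + c)%R) (sblk l1 l2 x d d' f))%N by lia.
have occd : ((c == d) <= occ (lv l1 y) (lv l2 (y + c)%R) (sblk l1 l2 x d d' f))%N.
  have -> : (c == d) = (c == (x + d) - x) by congr (_ == _); ring.
  by apply: occ_mixed; rewrite /sblk /points; case: (f); rewrite /= !inE !eqxx ?orbT.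
have occd' : ((c == d') <= occ (lv l1 y) (lv l2 (y + c)%R) (sblk l1 l2 x d d' f))%N.
  case defb : f.
    have -> : (c == d') = (c == (x + d) - (x + d - d')) by congr (_ == _); ring.
    by apply: occ_mixed; rewrite /sblk /points /= !inE !eqxx ?orbT.
  have -> : (c == d') = (c == (x + d') - x) by congr (_ == _); ring.
  by apply: occ_mixed; rewrite /sblk /points /= !inE !eqxx ?orbT.
by case: eqP occd occd' => [->|_] //=; rewrite (negbTE neq_d) addn0.
Qed.

Lemma steps_desc (h : nat -> G) (f : nat -> bool) lo k :
  steps (h ((lo + k).-1)%N) [seq (h t.-1, f t) | t <- rev (iota lo k)] =
  [seq (h t, h t.-1, f t) | t <- rev (iota lo k)].
Proof.
elim: k => // k IHk.
have -> : rev (iota lo k.+1) = (lo + k)%N :: rev (iota lo k).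
  by rewrite -[k.+1]addn1 iotaD rev_cat.
by rewrite !map_cons [steps _ _]/= IHk addnS.
Qed.

Lemma steps_asc (h : nat -> G) (f : nat -> bool) lo k :
  steps (h lo.-1) [seq (h t, f t) | t <- iota lo k] =
  [seq (h t.-1, h t, f t) | t <- iota lo k].
Proof. by elim: k lo => //= k IHk lo; have /= -> := IHk lo.+1. Qed.

Lemma steps_cat d ds ds' :
  steps d (ds ++ ds') = steps d ds ++ steps (last d (map fst ds)) ds'.
Proof. by elim: ds d => //= [[d' f] ds] IHds d; rewrite IHds. Qed.

(** Only flagged blocks move the base coordinate, so the flags determine the drift of a strand. *)
Lemma strand_endE x d ds :
  strand_end x d ds = x + \sum_(e <- steps d ds | e.2) (e.1.1 - e.1.2).
Proof.
elim: ds x d => [|[d' f] ds IHds] x d /=; first by rewrite big_nil addr0.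
by rewrite IHds big_cons /nextx /=; case: f => //; rewrite !addrA.
Qed.

End Strands.

(** * Differences inside one level, up to sign *)

Section PureDifferences.

Local Open Scope ring_scope.

Variable m : nat.
Notation n := m.+2.
Notation G := 'I_m.+2.
Notation pt := (G * 'I_3 + 'I_3)%type.

Lemma size_leq_sum (I : eqType) (r s : seq I) (F : I -> nat) : uniq s ->
  (forall i, i \in s -> (i \in r) && (0 < F i)%N) -> (size s <= \sum_(i <- r) F i)%N.
Proof.
move=> us sP; have: (size s <= size [seq i <- r | (0 < F i)%N])%N.
  by apply: uniq_leq_size => // i /sP; rewrite mem_filter andbC.
move/leq_trans; apply; rewrite size_filter -sum1_count big_mkcond.
by apply: leq_sum => i _; case: ifP.
Qed.

Lemma leq_sum_mem (I : eqType) (r : seq I) (F : I -> nat) i : i \in r ->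
  (F i <= \sum_(j <- r) F j)%N.
Proof. by move=> ir; rewrite (big_rem i) //= leq_addr. Qed.

Definition pm (t : nat) (d : G) : bool := (d == t%:R) || (d == - t%:R).

Lemma pmC t d d' : pm t (d - d') = pm t (d' - d).
Proof.
by rewrite /pm -[d' - d]opprB eqr_oppLR eqr_opp orbC.
Qed.

Lemma pm_compl t d : (t <= n)%N -> pm (n - t) d = pm t d.
Proof. by move=> tn; rewrite /pm natrB // natn0 sub0r opprK orbC. Qed.

Definition pmcount (c : G) (e : G * G * bool) : nat :=
  ((c == e.1.2 - e.1.1)%R + (c == e.1.1 - e.1.2)%R)%N.

Lemma pmcount_gt0 t c e : pm t c -> pm t (e.1.1 - e.1.2) -> (0 < pmcount c e)%N.
Proof.
rewrite /pmcount -[e.1.2 - _]opprB; move: (e.1.1 - e.1.2) => d.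
by move=> /orP[]/eqP-> /orP[]/eqP->; rewrite ?opprK eqxx ?addn1.
Qed.

(** If [2 * t = n] then [t = -t] in [Z_n], so a single step realises the difference with both
    signs. *)
Lemma pmcount_half t c e : (2 * t = n)%N -> pm t c -> pm t (e.1.1 - e.1.2) ->
  pmcount c e = 2.
Proof.
move=> t2; have tN : - t%:R = t%:R :> G.
  by apply/eqP; rewrite eq_sym -addr_eq0 -natrD addnn -mul2n t2 natn0.
rewrite /pmcount -[e.1.2 - _]opprB /pm tN !orbb => /eqP-> /eqP->.
by rewrite tN eqxx.
Qed.

Lemma occ_pure_pm l p q (y c : G) t (b : pt * pt * pt) : p != q ->
  lv l p \in points b -> lv l q \in points b -> pm t c -> pm t (p - q) ->
  (0 < occ (lv l y) (lv l (y + c)) b)%N.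
Proof.
move=> npq pb qb tc tpq; apply: leq_trans (occ_pure y c npq pb qb).
exact: (@pmcount_gt0 t c (p, q, true)).
Qed.

Section StrandPure.

Variables (la lb : 'I_3) (x d : G) (ds : seq (G * bool)).
Hypothesis dsN : forall e, e \in steps d ds -> e.1.1 != e.1.2.
Variables (f : bool) (y c : G).
Notation l := (if f then la else lb).
Notation total := (\sum_(b <- strand la lb x d ds) occ (lv l y) (lv l (y + c)) b)%N.

(** A flagged block has two points of level [la], an unflagged one two points of level [lb], at the
    difference of its two mixed differences. Thus [f] selects both the level and the contributing
    steps. *)
Lemma strand_pure : (\sum_(e <- steps d ds | e.2 == f) pmcount c e <= total)%N.
Proof.
rewrite big_mkcond; apply: (@strand_sum m _ (fun e => if e.2 == f then pmcount c e else 0%N)).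
move=> z [[d1 d2] f'] /dsN /= neq; case: eqP => // ->; rewrite /pmcount /sblk /=.
have [-> ->] : d2 - d1 = (z + d2) - (z + d1) /\ d1 - d2 = (z + d1) - (z + d2) by split; ring.
case: (f); last first.
  by apply: occ_pure; rewrite ?(inj_eq (addrI z)) // /points /= !inE !eqxx ?orbT.
have [-> ->] : z + d2 - (z + d1) = z - (z + d1 - d2) /\ z + d1 - (z + d2) = z + d1 - d2 - z.
  by split; ring.
rewrite addnC; apply: occ_pure; rewrite /points /= ?inE ?eqxx ?orbT //.
by rewrite eq_sym -subr_eq0 (_ : _ - z = d1 - d2) ?subr_eq0 //; ring.
Qed.

Lemma strand_pure_mem t e : e \in steps d ds -> e.2 == f -> pm t c ->
  pm t (e.1.1 - e.1.2) -> (0 < total)%N.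
Proof.
move=> ee ef tc te; apply: leq_trans strand_pure; rewrite big_mkcond.
by apply: leq_trans (leq_sum_mem _ ee); rewrite ef (pmcount_gt0 tc).
Qed.

Variables (E : nat -> G * G * bool) (r : seq nat) (s1 s2 : seq (G * G * bool)).
Hypothesis stepsE : steps d ds = s1 ++ map E r ++ s2.

(** Keeps only the regular middle part of the strand, indexed by [t]; the irregular steps [s1] and
    [s2] at the ends are discarded. *)
Lemma strand_pure_sub :
  (\sum_(t <- r) (if (E t).2 == f then pmcount c (E t) else 0) <= total)%N.
Proof.
apply: leq_trans strand_pure; rewrite stepsE !big_cat big_map /= -big_mkcond /=.
by apply: leq_trans (leq_addl _ _); rewrite leq_addr.
Qed.

Lemma strand_pure_ge t0 (s : seq nat) : uniq s -> pm t0 c ->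
  (forall t, t \in s -> [&& t \in r, (E t).2 == f & pm t0 ((E t).1.1 - (E t).1.2)]) ->
  (size s <= total)%N.
Proof.
move=> us t0c sP; apply: leq_trans strand_pure_sub; apply: size_leq_sum => // t.
by case/sP/and3P=> -> -> t0t; rewrite (pmcount_gt0 t0c).
Qed.

Lemma strand_pure_half t : (2 * t = n)%N -> pm t c -> t \in r -> (E t).2 == f ->
  pm t ((E t).1.1 - (E t).1.2) -> (2 <= total)%N.
Proof.
move=> t2 tc tr Ef tE; apply: leq_trans strand_pure_sub.
apply: leq_trans (leq_sum_mem _ tr); by rewrite Ef (pmcount_half t2).
Qed.

End StrandPure.

End PureDifferences.

(** * The zigzag sequence in Z_n *)

Section Zigzag.

Local Open Scope ring_scope.

Variable m : nat.
Notation n := m.+2.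
Notation G := 'I_m.+2.

Definition zigzag (t : nat) : G :=
  if odd t then (uphalf t)%:R else - t./2%:R.

Notation a := zigzag.

(** Step [t] has length [t] up to sign, so the steps [t] and [n - t] realise the same difference up
    to sign. *)
Lemma zigzag_step t : (0 < t)%N ->
  a t - a t.-1 = if odd t then t%:R else - t%:R.
Proof.
case: t => // t _; rewrite /a /= uphalf_half -(natr1 t).
have -> : t%:R = (odd t)%:R + t./2%:R + t./2%:R :> G.
  by rewrite -{1}[t]odd_double_half natrD -addnn natrD addrA.
by case: (odd t) => /=; ring.
Qed.

Lemma zigzag_pm t : (0 < t)%N -> pm t (a t - a t.-1).
Proof. by move=> t0; rewrite zigzag_step // /pm; case: ifP; rewrite eqxx ?orbT. Qed.

Lemma natG_eq0 t : (0 < t < n)%N -> (t%:R == 0 :> G) = false.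
Proof.
case/andP=> t0 tn; apply/eqP => /(congr1 val); rewrite Zp_nat /= modn_small //.
by move=> t0'; rewrite t0' in t0.
Qed.

Lemma zigzag_neq t : (0 < t < n)%N -> a t != a t.-1.
Proof.
move=> tn; rewrite -subr_eq0 zigzag_step; last by case/andP: tn.
by case: ifP => _; rewrite ?oppr_eq0 natG_eq0.
Qed.

(** Small nonzero residues [c] sit at the odd places [2c - 1], large ones at the even places
    [2(n - c)]. *)
Lemma zigzag_onto (c : G) : exists2 t, (t < n)%N & c = a t.
Proof.
have cn := ltn_ord c; have cE : c = (nat_of_ord c)%:R by rewrite natr_Zp.
case: (leqP (2 * c) n) => c2n.
  case: (posnP c) => [c0|c0].
    by exists 0%N; rewrite // cE c0 /a /= oppr0.
  exists c.-1.*2.+1; first by lia.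
  by rewrite /a /= odd_double /= doubleK prednK.
exists (n - c).*2; first by lia.
by rewrite /a odd_double doubleK natrB 1?ltnW // natn0 sub0r opprK.
Qed.

Lemma natG_repr (c : G) : c != 0 ->
  exists2 t, (0 < t)%N && (2 * t <= n)%N & pm t c.
Proof.
move=> c0; have cn := ltn_ord c; have cE : c = (nat_of_ord c)%:R by rewrite natr_Zp.
have cpos : (0 < c)%N by rewrite lt0n; apply: contra c0 => /eqP c0; rewrite cE c0.
case: (leqP (2 * c) n) => c2n.
  by exists (nat_of_ord c); rewrite ?cpos // /pm -cE eqxx.
exists (n - c)%N; first by lia.
by rewrite pm_compl 1?ltnW // /pm -cE eqxx.
Qed.

End Zigzag.

(** * The family of order 3n + 3 *)

Section Family.

Local Open Scope ring_scope.

Variable m : nat.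
Notation n := m.+2.
Notation G := 'I_m.+2.
Notation pt := (G * 'I_3 + 'I_3)%type.
Notation a := (zigzag m).
Hypothesis n_ge7 : (6 < n)%N.

Definition l0 : 'I_3 := @Ordinal 3 0 isT.
Definition l1 : 'I_3 := @Ordinal 3 1 isT.
Definition l2 : 'I_3 := @Ordinal 3 2 isT.
Notation A := (hole m l0).
Notation B := (hole m l1).
Notation C := (hole m l2).

(* The strands P, Q and R join the levels 0-1, 2-0 and 1-2. Each of them omits
   one zigzag value, hence one step, of length 1, 3 and 2 respectively; the three
   missing steps reappear as the differences of the block inside level 0 in
   [partB]. Flags move blocks of equal step length between the levels, so that
   each level sees every difference twice; those at [2 * t == n] and [t == 3]
   also make the total translation [base_end 0] a generator of [Z_n]. *)
Definition flipP t : bool := (t == 3) || (2 * t == n)%N.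
Definition flipQR t : bool := (t == m.-1) || (2 * t == n)%N.

(** The mixed differences are [1 - a t] on R, [a t] on P and [- (a t + 1)] on Q. The omitted index,
    namely 1, 0 and 2, is where the difference is 0, which [partU] takes over. *)
Definition dsR : seq (G * bool) :=
  (1 - a 2, false) :: [seq (1 - a t, flipQR t) | t <- iota 3 (m - 2)].
Definition dsP : seq (G * bool) :=
  [seq (a t.-1, flipP t) | t <- rev (iota 2 (m - 1))].
Definition dsQ : seq (G * bool) :=
  [seq (- (a t.-1 + 1), flipQR t) | t <- rev (iota 4 (m - 4))].

(** The strands stop short of this last zigzag value, and Q also of [a m]; those differences are
    left to the blocks connecting the strands. *)
Definition omega : G := a m.+1.
Definition kappa : G := a m.+1 - a m.
Notation w := omega.

(* The end of the passage through [A], the transversal, and [C]. *)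
Definition partU (s : G) : seq (pt * pt * pt) :=
  [:: (A, lv l1 s, lv l2 s); (lv l2 s, lv l1 s, lv l0 s);
      (lv l1 s, lv l0 s, C); (lv l0 s, C, lv l2 s); (C, lv l2 s, lv l1 (s - 1))].

(* The strip changes from R to P through a pair inside level 1. *)
Definition partRP (y : G) : seq (pt * pt * pt) :=
  [:: (lv l2 (y + (1 - a m)), lv l1 y, lv l1 (y + kappa));
      (lv l1 (y + kappa), lv l1 y, lv l0 (y - a m))].

(* The passage through [B], and the first two blocks of Q with the block inside
   level 0 between them. *)
Definition partB (X Z p : G) : seq (pt * pt * pt) :=
  [:: (lv l0 X, lv l1 (X + 1), B); (lv l1 (X + 1), B, lv l2 Z); (B, lv l2 Z, lv l0 p);
      (lv l2 Z, lv l0 p, lv l0 (p + kappa));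
      (lv l0 (p + kappa), lv l0 p, lv l0 (p - 2%:R * kappa));
      (lv l0 p, lv l0 (p - 2%:R * kappa), lv l2 (Z - kappa))].

Definition endR (y : G) := strand_end y 1 dsR.
Definition endP (X : G) := strand_end X (a m) dsP.
Definition endQ (Z : G) := strand_end Z (- (a m.-1 + 1)) (dsQ ++ [:: (- 1, true); (- 2%:R, true)]).

(** [y], [X] and [z] are the end coordinates of the strands R, P and Q, in levels 1, 0 and 2; [Z] is
    the level-2 coordinate reached after the hole [B]. *)
Definition base (x : G) : seq (pt * pt * pt) :=
  let y := endR (x + w - 1) in let X := endP (y - a m) in
  let Z := X + 2%:R - w in let z := endQ (Z - kappa) in
  (lv l0 x, A, lv l1 (x + w)) :: partU (x + w) ++ strand l1 l2 (x + w - 1) 1 dsR ++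
  partRP y ++ strand l0 l1 (y - a m) (a m) dsP ++ partB X Z (Z - w - 1) ++
  strand l2 l0 (Z - kappa) (- (a m.-1 + 1)) (dsQ ++ [:: (- 1, true); (- 2%:R, true)]) ++
  [:: (lv l2 z, lv l0 (z - 2%:R), A)].

(** The last step has length [n - 1], which is [-1] in [Z_n]. *)
Lemma kappaE : kappa = (if odd m then 1 else - 1).
Proof.
rewrite /kappa (zigzag_step m (t := m.+1)) //=.
have -> : m.+1%:R = - 1 :> G by apply/eqP; rewrite -addr_eq0 natr1 natn0.
by case: (odd m) => /=; rewrite ?opprK.
Qed.

(** Signs alternate and [m = -2] in [Z_n], so the step before the last is [-2 kappa]. *)
Lemma zigzag_pred : a m.-1 = a m + 2%:R * kappa.
Proof.
apply/eqP; rewrite -subr_eq0; apply/eqP.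
have := zigzag_step m (t := m); rewrite (_ : 0 < m)%N ?kappaE; last by lia.
have mE : m%:R = - 2%:R :> G by apply/eqP; rewrite -addr_eq0 -natrD addn2 natn0.
move/(_ isT) => eqs; transitivity (- (a m - a m.-1) - 2%:R * (if odd m then 1 else -1)); first by ring.
by rewrite eqs mE; case: (odd m) => /=; ring.
Qed.

(** * The base strip is a walk *)

Lemma last_dsR : last 1 (map fst dsR) = 1 - a m.
Proof.
rewrite /dsR /= (_ : (m - 2 = (m - 3).+1)%N); last by lia.
rewrite -[(m - 3).+1]addn1 iotaD !map_cat last_cat /=; congr (1 - a _); lia.
Qed.

Lemma last_dsP : last (a m) (map fst dsP) = 1.
Proof.
rewrite /dsP (_ : (m - 1 = (m - 2).+1)%N); last by lia.
by rewrite [iota _ _]/= rev_cons !map_rcons last_rcons /=.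
Qed.

Definition base_end x : G :=
  endQ (endP (endR (x + w - 1) - a m) + 2%:R - w - kappa) - 2%:R.

Lemma walk_base x : walk (lv l0 x, A) (base x) (lv l0 (base_end x), A).
Proof.
rewrite /base /base_end; set y := endR _; set X := endP _; set Z := X + _ - w.
set z := endQ _.
apply: (@cat_walk _ _ (_ :: partU _) (lv l1 (x + w - 1), lv l2 (x + w - 1 + 1))).
  rewrite subrK; do 2!apply: walk_cons; apply: walk_cons_swap.
  by do 3!apply: walk_cons; apply: walk_nil_swap.
apply: cat_walk (walk_strand _ _ _ _ _) _; rewrite last_dsR -/(endR _) -/y.
apply: (@cat_walk _ _ (partRP y) (lv l0 (y - a m), lv l1 (y - a m + a m))).
  by rewrite subrK; do 2!apply: walk_cons_swap; apply: walk_nil_swap.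
apply: cat_walk (walk_strand _ _ _ _ _) _; rewrite last_dsP -/(endP _) -/X.
apply: (@cat_walk _ _ (partB X Z (Z - w - 1)) (lv l2 (Z - kappa), lv l0 (Z - kappa - (a m.-1 + 1)))).
  have -> : Z - kappa - (a m.-1 + 1) = Z - w - 1 - 2%:R * kappa.
    by rewrite zigzag_pred /kappa /omega; ring.
  do 4!apply: walk_cons; apply: walk_cons_swap; apply: walk_cons.
  exact: walk_nil_swap.
apply: cat_walk (walk_strand _ _ _ _ _) _; rewrite -/(endQ _) -/z map_cat last_cat.
by apply: walk_cons; apply: walk_nil.
Qed.

(** * Steps of the strands and the total translation *)

Lemma steps_dsR : steps 1 dsR =
  (1, 1 - a 2, false) :: [seq (1 - a t.-1, 1 - a t, flipQR t) | t <- iota 3 (m - 2)].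
Proof. by rewrite /= (steps_asc (fun t => 1 - a t) flipQR 3). Qed.

Lemma steps_dsP : steps (a m) dsP =
  [seq (a t, a t.-1, flipP t) | t <- rev (iota 2 (m - 1))].
Proof.
have := steps_desc a flipP 2 (m - 1).
by rewrite (_ : ((2 + (m - 1)).-1)%N = m) //; lia.
Qed.

Lemma zigzag3 : a 3 = 2%:R. Proof. by []. Qed.

Lemma last_dsQ : last (- (a m.-1 + 1)) (map fst dsQ) = - 3%:R.
Proof.
rewrite /dsQ (_ : (m - 4 = (m - 5).+1)%N); last by lia.
rewrite [iota _ _]/= rev_cons !map_rcons last_rcons.
transitivity (- (a 3 + 1)) => //; rewrite zigzag3; ring.
Qed.

Lemma steps_dsQ :
  steps (- (a m.-1 + 1)) (dsQ ++ [:: (- 1, true); (- 2%:R, true)]) =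
  [seq (- (a t + 1), - (a t.-1 + 1), flipQR t) | t <- rev (iota 4 (m - 4))] ++
  [:: (- 3%:R, - 1, true); (- 1, - 2%:R, true)].
Proof.
rewrite steps_cat last_dsQ; congr (_ ++ _).
have := steps_desc (fun t => - (a t + 1)) flipQR 4 (m - 4).
by rewrite (_ : ((4 + (m - 4)).-1)%N = m.-1) //; lia.
Qed.

(** R and Q run through the zigzag in opposite directions with the same flags, so their drifts
    cancel. The final two steps of Q contribute the [-1]; steps 3 and [m] of R are unflagged. *)
Lemma endR_add_endQ : exists S : G, (forall y, endR y = y + S) /\
  (forall Z, endQ Z = Z - S - 1).
Proof.
exists (\sum_(t <- iota 4 (m - 4) | flipQR t) (a t - a t.-1)); split=> [y|Z].
  rewrite /endR strand_endE steps_dsR big_cons /= big_map /=; congr (y + _).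
  have -> : iota 3 (m - 2) = 3 :: iota 4 (m - 4) ++ [:: m].
    rewrite (_ : (m - 2 = 1 + (m - 4) + 1)%N); last by lia.
    by rewrite !iotaD /=; congr (_ :: _ ++ [:: _]); lia.
  rewrite big_cons big_cat big_cons big_nil /= (_ : flipQR 3 = false); last by rewrite /flipQR; lia.
  rewrite (_ : flipQR m = false) ?addr0; last by rewrite /flipQR; lia.
  by apply: eq_bigr => t _; ring.
rewrite /endQ strand_endE steps_dsQ big_cat big_map !big_cons big_nil /=.
rewrite (perm_big (iota 4 (m - 4))) ?perm_rev //=.
rewrite (eq_bigr (fun t => - (a t - a t.-1))) => [|t _]; last by ring.
by rewrite sumrN; ring.
Qed.

(** For odd [n] only step 3 is flagged and the translation is [(n + 1) / 2], with inverse 2. For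
    even [n] the flagged step [n / 2] cancels [w = n / 2], leaving 1. *)
Lemma endP_add : exists S : G, (forall X, endP X = X + S) /\
  exists c, c * (S - 2%:R - w) = 1.
Proof.
pose F t := a t - a t.-1.
exists (\sum_(t <- iota 2 (m - 1) | flipP t) F t); split=> [X|].
  rewrite /endP strand_endE steps_dsP big_map.
  by rewrite (perm_big (iota 2 (m - 1))) ?perm_rev.
rewrite big_mkcond (bigD1_seq 3) ?iota_uniq //=; last by rewrite mem_iota; lia.
have -> : F 3 = 3%:R by rewrite /F zigzag_step.
have wE : w = if odd m then - ((m.+1)./2)%:R else (m./2.+1)%:R.
  by rewrite /w /omega /zigzag /=; case: (odd m).
case: (boolP (odd m)) => om.
  rewrite big1_seq => [|t]; last first.
    by case/andP=> t3 _; rewrite ifF //; rewrite /flipP; lia.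
  exists 2%:R; rewrite wE om; have mE : m.+1%:R = 2%:R * (m.+1)./2%:R :> G.
    by rewrite -natrM mul2n -[in LHS](odd_double_half m.+1) /= om.
  transitivity (m.+1%:R + 2%:R : G); first by rewrite mE; ring.
  by rewrite -natrD addn2 -(natr1 n) natn0 add0r.
pose h := m./2.+1; have hn : (2 * h)%N = n by rewrite /h; lia.
have h3 : (h != 3)%N by lia.
rewrite big_mkcond (bigD1_seq h) ?iota_uniq //=; last by rewrite mem_iota; lia.
rewrite big1_seq => [|t /andP[th _]]; last first.
  by case: ifP => // t3; rewrite ifF //; rewrite /flipP; lia.
rewrite h3 ifT; last by rewrite /flipP hn eqxx orbT.
exists 1; rewrite wE (negbTE om) -/h mul1r /F zigzag_step //.
have h2 : h%:R + h%:R = 0 :> G by rewrite -natrD addnn -mul2n hn natn0.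
case: ifP => _; first by ring.
by transitivity (1 - (h%:R + h%:R) : G); [ring | rewrite h2 subr0].
Qed.

Lemma base_end_gen : exists c, c * base_end 0 = 1.
Proof.
have [S [RE QE]] := endR_add_endQ; have [S' [PE [c cE]]] := endP_add.
exists c; rewrite -[RHS]cE /base_end QE PE RE /kappa /omega; congr (c * _); ring.
Qed.

Notation dQ := (- (a m.-1 + 1))%R.
Notation dsQ2 := (dsQ ++ [:: (- 1, true); (- 2%:R, true)])%R.

(** * Pairs between two levels *)

Lemma sum_base (F : pt * pt * pt -> nat) x :
  let y := endR (x + w - 1) in let X := endP (y - a m) in
  let Z := X + 2%:R - w in let z := endQ (Z - kappa) in
  (\sum_(b <- base x) F b = F (lv l0 x, A, lv l1 (x + w)) +
   \sum_(b <- partU (x + w)%R) F b +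
   \sum_(b <- strand l1 l2 (x + w - 1)%R 1%R dsR) F b + \sum_(b <- partRP y) F b +
   \sum_(b <- strand l0 l1 (y - a m)%R (a m) dsP) F b + \sum_(b <- partB X Z (Z - w - 1)%R) F b +
   \sum_(b <- strand l2 l0 (Z - kappa)%R dQ dsQ2) F b + F (lv l2 z, lv l0 (z - 2%:R), A))%N.
Proof. by rewrite /base big_cons !big_cat big_seq1 /= !addnA. Qed.

Lemma sum_partU (F : pt * pt * pt -> nat) s :
  (\sum_(b <- partU s) F b = F (A, lv l1 s, lv l2 s) + F (lv l2 s, lv l1 s, lv l0 s) +
    F (lv l1 s, lv l0 s, C) + F (lv l0 s, C, lv l2 s) + F (C, lv l2 s, lv l1 (s - 1)))%N.
Proof. by rewrite /partU !big_cons big_nil addn0 !addnA. Qed.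

Lemma sum_partRP (F : pt * pt * pt -> nat) y :
  (\sum_(b <- partRP y) F b = F (lv l2 (y + (1 - a m)), lv l1 y, lv l1 (y + kappa)) +
    F (lv l1 (y + kappa), lv l1 y, lv l0 (y - a m)))%N.
Proof. by rewrite /partRP !big_cons big_nil addn0. Qed.

Lemma sum_partB (F : pt * pt * pt -> nat) X Z p :
  (\sum_(b <- partB X Z p) F b =
    F (lv l0 X, lv l1 (X + 1), B) + F (lv l1 (X + 1), B, lv l2 Z) +
    F (B, lv l2 Z, lv l0 p) + F (lv l2 Z, lv l0 p, lv l0 (p + kappa)) +
    F (lv l0 (p + kappa), lv l0 p, lv l0 (p - 2%:R * kappa)) +
    F (lv l0 p, lv l0 (p - 2%:R * kappa), lv l2 (Z - kappa)))%N.
Proof. by rewrite /partB !big_cons big_nil addn0 !addnA. Qed.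

Lemma stepsR_neq e : e \in steps 1 dsR -> e.1.1 != e.1.2.
Proof.
rewrite steps_dsR inE => /orP[/eqP-> | /mapP[t]] /=.
  rewrite -subr_eq0 (_ : _ - _ = - 1%:R); last by rewrite /zigzag /=; ring.
  by rewrite oppr_eq0 natG_eq0.
rewrite mem_iota => tm -> /=; rewrite (inj_eq (addrI 1)) eqr_opp eq_sym.
by apply: zigzag_neq; lia.
Qed.

Lemma stepsP_neq e : e \in steps (a m) dsP -> e.1.1 != e.1.2.
Proof.
rewrite steps_dsP => /mapP[t]; rewrite mem_rev mem_iota => tm -> /=.
by apply: zigzag_neq; lia.
Qed.

Lemma stepsQ_neq e :
  e \in steps dQ dsQ2 -> e.1.1 != e.1.2.
Proof.
rewrite steps_dsQ mem_cat => /orP[/mapP[t]|].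
  rewrite mem_rev mem_iota => tm -> /=; rewrite eqr_opp (inj_eq (addIr 1)).
  by apply: zigzag_neq; lia.
rewrite !inE => /orP[]/eqP-> /=; rewrite eqr_opp -subr_eq0.
  rewrite (_ : _ - _ = 2%:R); last by ring.
  by rewrite natG_eq0 //; lia.
by rewrite (_ : _ - _ = - 1%:R) ?oppr_eq0 ?natG_eq0 //; ring.
Qed.

Lemma kappa_pm k : pm k (k%:R * kappa).
Proof. by rewrite kappaE /pm; case: (odd m); rewrite ?mulrN mulr1 eqxx ?orbT. Qed.

Lemma kappa_neq0 k : (0 < k < n)%N -> k%:R * kappa != 0.
Proof.
by move=> kn; rewrite kappaE; case: (odd m); rewrite ?mulrN mulr1 ?oppr_eq0 natG_eq0.
Qed.

(** The deficits [k1], [k2] at the ends of a strand, as in [strand_mixed], are made up by adjoining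
    blocks [f1], [f2]. *)
Lemma strand_ends (cnt k1 k2 S f1 f2 : nat) : (0 < cnt -> 2 * cnt <= S + k1 + k2 ->
  k1 <= f1 -> k2 <= f2 -> 2 <= S + f1 + f2)%N.
Proof. lia. Qed.

Lemma mem_points (T : eqType) (u w' z : T) : (u \in points (u, w', z)) *
  (w' \in points (u, w', z)) * (z \in points (u, w', z)).
Proof. by rewrite /points /= !inE !eqxx !orbT. Qed.

Lemma occ_mixed_eq la lb (y c d p q : G) b : lv la p \in points b -> lv lb q \in points b ->
  d = q - p -> ((c == d) <= occ (lv la y) (lv lb (y + c)) b)%N.
Proof. by move=> pb qb ->; apply: occ_mixed. Qed.

(** With [c = a t], the value [t = 0] belongs to [partU] and [t = m + 1] to the blocks [bA] and
    [bP]. The others lie on strand P, whose end differences [a m] and 1 are completed by [bP] and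
    [bB]. *)
Lemma cover_mixedP (x y c : G) :
  (2 <= \sum_(b <- base x) occ (lv l0 y) (lv l1 (y + c)) b)%N.
Proof.
rewrite sum_base sum_partU sum_partRP sum_partB.
set Y := endR _; set X := endP _.
pose bU : pt * pt * pt := (lv l2 (x + w), lv l1 (x + w), lv l0 (x + w)).
pose bC : pt * pt * pt := (lv l1 (x + w), lv l0 (x + w), C).
pose bA : pt * pt * pt := (lv l0 x, A, lv l1 (x + w)).
pose bP : pt * pt * pt := (lv l1 (Y + kappa), lv l1 Y, lv l0 (Y - a m)).
pose bB : pt * pt * pt := (lv l0 X, lv l1 (X + 1), B).
rewrite -/bU -/bC -/bA -/bP -/bB.
have occE b (d p q : G) := @occ_mixed_eq l0 l1 y c d p q b.
have [t tn cE] := zigzag_onto c.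
have [t0|tpos] := posnP t.
  have c0 : c == 0 by rewrite cE t0 /zigzag /= oppr0.
  have := @occE bU 0 (x + w) (x + w); have := @occE bC 0 (x + w) (x + w).
  rewrite !mem_points subrr c0 => /(_ isT isT erefl) h1 /(_ isT isT erefl) h2; lia.
have [tm|tm] := ltnP m t.
  have cw : c == w by rewrite cE /omega (_ : t = m.+1) //; lia.
  have := @occE bA w x (x + w); have := @occE bP w (Y - a m) (Y + kappa).
  rewrite !mem_points cw => /(_ isT isT) h1 /(_ isT isT) h2.
  have {}h1 := h1 ltac:(rewrite /kappa /omega; ring).
  have {}h2 := h2 ltac:(ring).
  lia.
have cnt : (0 < count_mem c (a m :: map fst dsP))%N.
  rewrite -has_count has_pred1 inE; have [tm'|ntm] := eqVneq t m; first by rewrite cE tm' eqxx.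
  apply/orP; right; rewrite cE /dsP -map_comp; apply/mapP; exists t.+1 => //.
  by rewrite mem_rev mem_iota; lia.
have := strand_mixed l0 l1 (Y - a m) y c stepsP_neq; rewrite last_dsP => hS.
have := @occE bP (a m) (Y - a m) Y; have := @occE bB 1 X (X + 1).
rewrite !mem_points => /(_ isT isT) h1 /(_ isT isT) h2.
have {}h1 := h1 ltac:(ring).
have {}h2 := h2 ltac:(ring).
have := strand_ends cnt hS h2 h1; lia.
Qed.

Lemma cover_mixedR (x y c : G) :
  (2 <= \sum_(b <- base x) occ (lv l1 y) (lv l2 (y + c)) b)%N.
Proof.
rewrite sum_base sum_partU sum_partRP sum_partB.
set Y := endR _; set X := endP _; set Z := X + _ - w.
pose bU : pt * pt * pt := (lv l2 (x + w), lv l1 (x + w), lv l0 (x + w)).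
pose bC : pt * pt * pt := (C, lv l2 (x + w), lv l1 (x + w - 1)).
pose bA : pt * pt * pt := (A, lv l1 (x + w), lv l2 (x + w)).
pose bR : pt * pt * pt := (lv l2 (Y + (1 - a m)), lv l1 Y, lv l1 (Y + kappa)).
pose bB : pt * pt * pt := (lv l1 (X + 1), B, lv l2 Z).
rewrite -/bU -/bC -/bA -/bR -/bB.
have occE b (d p q : G) := @occ_mixed_eq l1 l2 y c d p q b.
have [t tn cE'] := zigzag_onto (1 - c).
have {cE'} cE : c = 1 - a t by rewrite -cE'; ring.
have [t1|nt1] := eqVneq t 1%N.
  have c0 : c == 0 by rewrite cE t1 /zigzag /= subrr.
  have := @occE bU 0 (x + w) (x + w); have := @occE bA 0 (x + w) (x + w).
  rewrite !mem_points subrr c0 => /(_ isT isT erefl) h1 /(_ isT isT erefl) h2; lia.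
have [tm|tm] := ltnP m t.
  have cw : c == 1 - w by rewrite cE /omega (_ : t = m.+1) //; lia.
  have := @occE bR (1 - w) (Y + kappa) (Y + (1 - a m)); have := @occE bB (1 - w) (X + 1) Z.
  rewrite !mem_points cw => /(_ isT isT) h1 /(_ isT isT) h2.
  have {}h1 := h1 ltac:(rewrite /Z; ring).
  have {}h2 := h2 ltac:(rewrite /kappa /omega; ring).
  lia.
have cnt : (0 < count_mem c (1%R :: map fst dsR))%N.
  rewrite -has_count has_pred1 inE; have [t0|nt0] := posnP t.
    by rewrite cE t0 /zigzag /= oppr0 subr0 eqxx.
  apply/orP; right; rewrite /dsR map_cons inE; have [t2|nt2] := eqVneq t 2%N.
    by rewrite cE t2 eqxx.
  apply/orP; right; rewrite cE -map_comp; apply/mapP; exists t => //.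
  by rewrite mem_iota; lia.
have := strand_mixed l1 l2 (x + w - 1) y c stepsR_neq; rewrite last_dsR => hS.
have := @occE bR (1 - a m) Y (Y + (1 - a m)); have := @occE bC 1 (x + w - 1) (x + w).
rewrite !mem_points => /(_ isT isT) h1 /(_ isT isT) h2.
have {}h1 := h1 ltac:(ring).
have {}h2 := h2 ltac:(ring).
have := strand_ends cnt hS h1 h2; lia.
Qed.

(** Here [c = - (a t + 1)], and both [t = m] and [t = m + 1] fall outside the strand, to the blocks
    of [partB]. *)
Lemma cover_mixedQ (x y c : G) :
  (2 <= \sum_(b <- base x) occ (lv l2 y) (lv l0 (y + c)) b)%N.
Proof.
rewrite sum_base sum_partU sum_partRP sum_partB.
set Y := endR _; set X := endP _; set Z := X + _ - w; set z := endQ _.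
set p := Z - w - 1.
pose bU : pt * pt * pt := (lv l2 (x + w), lv l1 (x + w), lv l0 (x + w)).
pose bC : pt * pt * pt := (lv l0 (x + w), C, lv l2 (x + w)).
pose bA : pt * pt * pt := (lv l2 z, lv l0 (z - 2%:R), A).
pose bB : pt * pt * pt := (B, lv l2 Z, lv l0 p).
pose b1 : pt * pt * pt := (lv l2 Z, lv l0 p, lv l0 (p + kappa)).
pose b2 : pt * pt * pt := (lv l0 p, lv l0 (p - 2%:R * kappa), lv l2 (Z - kappa)).
rewrite -/bU -/bC -/bA -/bB -/b1 -/b2.
have occE b (d p q : G) := @occ_mixed_eq l2 l0 y c d p q b.
have [t tn cE'] := zigzag_onto (- c - 1).
have {cE'} cE : c = - (a t + 1) by rewrite -cE'; ring.
have [t2|nt2] := eqVneq t 2%N.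
  have c0 : c == 0 by rewrite cE t2 /zigzag /= addNr oppr0.
  have := @occE bU 0 (x + w) (x + w); have := @occE bC 0 (x + w) (x + w).
  rewrite !mem_points subrr c0 => /(_ isT isT erefl) h1 /(_ isT isT erefl) h2; lia.
have [tm|tm] := ltnP m t.
  have cw : c == - (w + 1) by rewrite cE /omega (_ : t = m.+1) //; lia.
  have := @occE bB (- (w + 1)) Z p; have := @occE b1 (- (w + 1)) Z p.
  rewrite !mem_points cw => /(_ isT isT) h1 /(_ isT isT) h2.
  have {}h1 := h1 ltac:(rewrite /p; ring).
  have {}h2 := h2 ltac:(rewrite /p; ring).
  lia.
have [tm'|ntm] := eqVneq t m.
  have cw : c == - (a m + 1) by rewrite cE tm'.
  have := @occE b1 (- (a m + 1)) Z (p + kappa).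
  have := @occE b2 (- (a m + 1)) (Z - kappa) p.
  rewrite !mem_points cw => /(_ isT isT) h1 /(_ isT isT) h2.
  have {}h1 := h1 ltac:(rewrite /p /kappa /omega; ring).
  have {}h2 := h2 ltac:(rewrite /p /kappa /omega; ring).
  lia.
have cnt : (0 < count_mem c (dQ :: map fst dsQ2))%N.
  rewrite -has_count has_pred1 inE; have [tm1|ntm1] := eqVneq t m.-1.
    by rewrite cE tm1 eqxx.
  apply/orP; right; rewrite map_cat mem_cat; have [t3|t3] := ltnP 2 t.
    apply/orP; left; rewrite cE /dsQ -map_comp; apply/mapP; exists t.+1 => //.
    by rewrite mem_rev mem_iota; lia.
  apply/orP; right; rewrite cE !inE; have [->|->] : t = 0%N \/ t = 1%N by lia.
    by rewrite /zigzag /= oppr0 add0r eqxx.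
  by rewrite /zigzag /= [1 + 1]/(2%:R) eqxx orbT.
have lastQ : last dQ (map fst dsQ2) = - 2%:R by rewrite map_cat last_cat.
have := strand_mixed l2 l0 (Z - kappa) y c stepsQ_neq; rewrite lastQ => hS.
have := @occE b2 dQ (Z - kappa) (p - 2%:R * kappa); have := @occE bA (- 2%:R) z (z - 2%:R).
rewrite !mem_points => /(_ isT isT) h1 /(_ isT isT) h2.
have {}h1 := h1 ltac:(ring).
have {}h2 := h2 ltac:(rewrite zigzag_pred /p /kappa /omega; ring).
have := strand_ends cnt hS h2 h1; lia.
Qed.

(** * Pairs inside a level *)

Lemma zigzag_pm2 t t0 : (0 < t)%N -> (t == t0) || (t + t0 == n)%N -> pm t0 (a t - a t.-1).
Proof.
move=> tpos /orP[/eqP<-|/eqP tn]; first exact: zigzag_pm.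
have tE : t = (n - t0)%N by lia.
by have := zigzag_pm m tpos; rewrite {1}tE pm_compl //; lia.
Qed.

(** [s] lists steps of P, of index [t0] or [n - t0], whose flag assigns them to level [l]. *)
Lemma pureP x f (y c : G) t0 s k l : k = size s ->
  l = (if f then l0 else l1) -> uniq s -> pm t0 c ->
  (forall t, t \in s -> [&& 1 < t, t <= m, flipP t == f & (t == t0) || (t + t0 == n)]%N) ->
  (k <= \sum_(b <- strand l0 l1 x (a m) dsP)
    occ (lv l y) (lv l (y + c)) b)%N.
Proof.
move=> -> -> us t0c sP; apply: (@strand_pure_ge m l0 l1 x (a m) dsP stepsP_neq f y c
  (fun t => (a t, a t.-1, flipP t)) (rev (iota 2 (m - 1))) [::] [::] _ t0) => //.
  by rewrite steps_dsP cats0.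
move=> t /sP/and4P[t2 tm tf tt]; rewrite tf mem_rev mem_iota zigzag_pm2 //; lia.
Qed.

Lemma pureR x f (y c : G) t0 s k l : k = size s ->
  l = (if f then l1 else l2) -> uniq s -> pm t0 c ->
  (forall t, t \in s -> [&& 2 < t, t <= m, flipQR t == f & (t == t0) || (t + t0 == n)]%N) ->
  (k <= \sum_(b <- strand l1 l2 x 1%R dsR)
    occ (lv l y) (lv l (y + c)) b)%N.
Proof.
move=> -> -> us t0c sP; apply: (@strand_pure_ge m l1 l2 x 1 dsR stepsR_neq f y c
  (fun t => (1 - a t.-1, 1 - a t, flipQR t)) (iota 3 (m - 2)) [:: (1, 1 - a 2, false)] [::] _ t0) => //.
  by rewrite steps_dsR cats0.
move=> t /sP/and4P[t2 tm tf tt]; rewrite tf mem_iota /= (_ : _ - _ = a t - a t.-1); last by ring.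
by rewrite zigzag_pm2 //; lia.
Qed.

Lemma pureQ x f (y c : G) t0 s k l : k = size s ->
  l = (if f then l2 else l0) -> uniq s -> pm t0 c ->
  (forall t, t \in s -> [&& 3 < t, t < m, flipQR t == f & (t == t0) || (t + t0 == n)]%N) ->
  (k <= \sum_(b <- strand l2 l0 x dQ dsQ2)
    occ (lv l y) (lv l (y + c)) b)%N.
Proof.
move=> -> -> us t0c sP; apply: (@strand_pure_ge m l2 l0 x dQ dsQ2 stepsQ_neq f y c
  (fun t => (- (a t + 1), - (a t.-1 + 1), flipQR t)) (rev (iota 4 (m - 4))) [::]
  [:: (- 3%:R, - 1, true); (- 1, - 2%:R, true)] _ t0) => //.
  by rewrite steps_dsQ.
move=> t /sP/and4P[t2 tm tf tt]; rewrite tf mem_rev mem_iota /=.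
rewrite (_ : _ - _ = a t.-1 - a t); last by ring.
by rewrite pmC zigzag_pm2 //; lia.
Qed.

(** The flagged step [n / 2] of a strand supplies its difference twice: P serves level 0, R level 1
    and Q level 2. *)
Lemma halfP x (y c : G) t : (2 * t = n)%N -> pm t c ->
  (2 <= \sum_(b <- strand l0 l1 x (a m) dsP) occ (lv l0 y) (lv l0 (y + c)) b)%N.
Proof.
move=> t2 tc; apply: (@strand_pure_half m l0 l1 x (a m) dsP stepsP_neq true y c
  (fun t => (a t, a t.-1, flipP t)) (rev (iota 2 (m - 1))) [::] [::] _ t) => //.
- by rewrite steps_dsP cats0.
- by rewrite mem_rev mem_iota; lia.
- by rewrite /= /flipP t2 eqxx orbT.
by apply: zigzag_pm; lia.
Qed.

Lemma halfR x (y c : G) t : (2 * t = n)%N -> pm t c ->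
  (2 <= \sum_(b <- strand l1 l2 x 1%R dsR) occ (lv l1 y) (lv l1 (y + c)) b)%N.
Proof.
move=> t2 tc; apply: (@strand_pure_half m l1 l2 x 1 dsR stepsR_neq true y c
  (fun t => (1 - a t.-1, 1 - a t, flipQR t)) (iota 3 (m - 2)) [:: (1, 1 - a 2, false)] [::] _ t) => //.
- by rewrite steps_dsR cats0.
- by rewrite mem_iota; lia.
- by rewrite /= /flipQR t2 eqxx orbT.
rewrite /= (_ : _ - _ = a t - a t.-1); last by ring.
by apply: zigzag_pm; lia.
Qed.

Lemma halfQ x (y c : G) t : (2 * t = n)%N -> pm t c ->
  (2 <= \sum_(b <- strand l2 l0 x dQ dsQ2) occ (lv l2 y) (lv l2 (y + c)) b)%N.
Proof.
move=> t2 tc; apply: (@strand_pure_half m l2 l0 x dQ dsQ2 stepsQ_neq true y c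
  (fun t => (- (a t + 1), - (a t.-1 + 1), flipQR t)) (rev (iota 4 (m - 4))) [::]
  [:: (- 3%:R, - 1, true); (- 1, - 2%:R, true)] _ t) => //.
- by rewrite steps_dsQ.
- by rewrite mem_rev mem_iota; lia.
- by rewrite /= /flipQR t2 eqxx orbT.
rewrite /= (_ : _ - _ = a t.-1 - a t); last by ring.
by rewrite pmC; apply: zigzag_pm; lia.
Qed.

Lemma occ_kappa l p q (y c : G) k b : (0 < k < n)%N -> pm k c -> p - q = k%:R * kappa ->
  lv l p \in points b -> lv l q \in points b -> (0 < occ (lv l y) (lv l (y + c)) b)%N.
Proof.
move=> kn kc pq pb qb; apply: occ_pure_pm pb qb kc _; last by rewrite pq kappa_pm.
by rewrite -subr_eq0 pq kappa_neq0.
Qed.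

(** Level 1 gets length 1 from [partRP] and most lengths from P. Step 3 of P is flagged away, and
    the flagged step [n - 3] of R replaces it; [n / 2] comes from R. *)
Lemma cover_pure1 (x y c : G) : c != 0 ->
  (2 <= \sum_(b <- base x) occ (lv l1 y) (lv l1 (y + c)) b)%N.
Proof.
case/natG_repr=> t /andP[tpos t2n] tc.
rewrite sum_base sum_partU sum_partRP sum_partB.
set Y := endR _.
have [t1|nt1] := eqVneq t 1%N.
  rewrite t1 in tc; set b1 := (_, lv l1 Y, lv l1 _); set b2 := (_, lv l1 Y, lv l0 _).
  have h1 : (0 < occ (lv l1 y) (lv l1 (y + c)) b1)%N.
    by apply: (@occ_kappa l1 (Y + kappa) Y _ _ 1); rewrite ?mem_points //; ring.
  have h2 : (0 < occ (lv l1 y) (lv l1 (y + c)) b2)%N.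
    by apply: (@occ_kappa l1 (Y + kappa) Y _ _ 1); rewrite ?mem_points //; ring.
  lia.
have [t3|nt3] := eqVneq t 3.
  have h1 := @pureP (Y - a m) false y c t [:: m.-1] 1 l1 erefl erefl isT tc.
  have h2 := @pureR (x + w - 1) true y c t [:: m.-1] 1 l1 erefl erefl isT tc.
  have {}h1 := h1 ltac:(move=> j; rewrite inE /flipP; lia).
  have {}h2 := h2 ltac:(move=> j; rewrite inE /flipQR; lia).
  lia.
have [tn|ntn] := eqVneq (2 * t)%N n.
  have h1 := halfR (x + w - 1) y tn tc; lia.
have h1 := @pureP (Y - a m) false y c t [:: t; (n - t)%N] 2 l1 erefl erefl _ tc.
have {}h1 := h1 ltac:(rewrite /= inE; lia) ltac:(move=> j; rewrite !inE /flipP; lia).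
lia.
Qed.

(** [bI] gives the lengths 1, 2, 3 once each; the second occurrences come from [b1], [b2] and the
    flagged step 3 of P. P supplies [n / 2] and Q the rest. *)
Lemma cover_pure0 (x y c : G) : c != 0 ->
  (2 <= \sum_(b <- base x) occ (lv l0 y) (lv l0 (y + c)) b)%N.
Proof.
case/natG_repr=> t /andP[tpos t2n] tc.
rewrite sum_base sum_partU sum_partRP sum_partB.
set Y := endR _; set X := endP _; set Z := X + _ - w; set p := Z - w - 1.
pose b1 : pt * pt * pt := (lv l2 Z, lv l0 p, lv l0 (p + kappa)).
pose bI : pt * pt * pt := (lv l0 (p + kappa), lv l0 p, lv l0 (p - 2%:R * kappa)).
pose b2 : pt * pt * pt := (lv l0 p, lv l0 (p - 2%:R * kappa), lv l2 (Z - kappa)).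
rewrite -/b1 -/bI -/b2.
have [t1|nt1] := eqVneq t 1%N.
  rewrite t1 in tc.
  have h1 : (0 < occ (lv l0 y) (lv l0 (y + c)) b1)%N.
    by apply: (@occ_kappa l0 (p + kappa) p _ _ 1); rewrite ?mem_points //; ring.
  have h2 : (0 < occ (lv l0 y) (lv l0 (y + c)) bI)%N.
    by apply: (@occ_kappa l0 (p + kappa) p _ _ 1); rewrite ?mem_points //; ring.
  lia.
have [t2|nt2] := eqVneq t 2%N.
  rewrite t2 in tc; have n2 : (0 < 2 < n)%N by lia.
  have h1 : (0 < occ (lv l0 y) (lv l0 (y + c)) b2)%N.
    by apply: (@occ_kappa l0 p (p - 2%:R * kappa) _ _ 2); rewrite ?mem_points //; ring.
  have h2 : (0 < occ (lv l0 y) (lv l0 (y + c)) bI)%N.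
    by apply: (@occ_kappa l0 p (p - 2%:R * kappa) _ _ 2); rewrite ?mem_points //; ring.
  lia.
have [t3|nt3] := eqVneq t 3.
  have h1 := @pureP (Y - a m) true y c t [:: 3] 1 l0 erefl erefl isT tc.
  have {}h1 := h1 ltac:(move=> j; rewrite inE /flipP; lia).
  rewrite t3 in tc; have n3 : (0 < 3 < n)%N by lia.
  have h2 : (0 < occ (lv l0 y) (lv l0 (y + c)) bI)%N.
    by apply: (@occ_kappa l0 (p + kappa) (p - 2%:R * kappa) _ _ 3); rewrite ?mem_points //; ring.
  lia.
have [tn|ntn] := eqVneq (2 * t)%N n.
  have h1 := halfP (Y - a m) y tn tc; lia.
have h1 := @pureQ (Z - kappa) false y c t [:: t; (n - t)%N] 2 l0 erefl erefl _ tc.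
have {}h1 := h1 ltac:(rewrite /= inE; lia) ltac:(move=> j; rewrite !inE /flipQR; lia).
lia.
Qed.

(** R supplies most lengths. For 1, 2 and 3 it gives one occurrence, and the second comes from
    flagged steps of Q, the last two and step [n - 3]; Q also supplies [n / 2]. *)
Lemma cover_pure2 (x y c : G) : c != 0 ->
  (2 <= \sum_(b <- base x) occ (lv l2 y) (lv l2 (y + c)) b)%N.
Proof.
case/natG_repr=> t /andP[tpos t2n] tc.
rewrite sum_base sum_partU sum_partRP sum_partB.
set Y := endR _; set X := endP _; set Z := X + _ - w.
have [t1|nt1] := eqVneq t 1%N.
  rewrite t1 in tc.
  have h1 : (0 < \sum_(b <- strand l1 l2 (x + w - 1)%R 1%R dsR) occ (lv l2 y) (lv l2 (y + c)) b)%N.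
    apply: (@strand_pure_mem m l1 l2 (x + w - 1) 1 dsR stepsR_neq false y c 1 (1, 1 - a 2, false)) => //.
      by rewrite steps_dsR mem_head.
    by rewrite /pm (_ : _ - _ = - 1%:R) ?eqxx ?orbT // /zigzag /=; ring.
  have h2 : (0 < \sum_(b <- strand l2 l0 (Z - kappa)%R dQ dsQ2) occ (lv l2 y) (lv l2 (y + c)) b)%N.
    apply: (@strand_pure_mem m l2 l0 (Z - kappa) dQ dsQ2 stepsQ_neq true y c 1 (- 1, - 2%:R, true)) => //.
      by rewrite steps_dsQ mem_cat !inE eqxx !orbT.
    by rewrite /pm (_ : _ - _ = 1%:R) ?eqxx //=; ring.
  lia.
have [t2|nt2] := eqVneq t 2%N.
  rewrite t2 in tc.
  have h1 := @pureR (x + w - 1) false y c 2 [:: m] 1 l2 erefl erefl isT tc.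
  have {}h1 := h1 ltac:(move=> j; rewrite inE /flipQR; lia).
  have h2 : (0 < \sum_(b <- strand l2 l0 (Z - kappa)%R dQ dsQ2) occ (lv l2 y) (lv l2 (y + c)) b)%N.
    apply: (@strand_pure_mem m l2 l0 (Z - kappa) dQ dsQ2 stepsQ_neq true y c 2 (- 3%:R, - 1, true)) => //.
      by rewrite steps_dsQ mem_cat !inE eqxx !orbT.
    by rewrite /pm (_ : _ - _ = - 2%:R) ?eqxx ?orbT //=; ring.
  lia.
have [t3|nt3] := eqVneq t 3.
  have h1 := @pureR (x + w - 1) false y c t [:: 3] 1 l2 erefl erefl isT tc.
  have {}h1 := h1 ltac:(move=> j; rewrite inE /flipQR; lia).
  have h2 := @pureQ (Z - kappa) true y c t [:: m.-1] 1 l2 erefl erefl isT tc.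
  have {}h2 := h2 ltac:(move=> j; rewrite inE /flipQR; lia).
  lia.
have [tn|ntn] := eqVneq (2 * t)%N n.
  have h1 := halfQ (Z - kappa) y tn tc; lia.
have h1 := @pureR (x + w - 1) false y c t [:: t; (n - t)%N] 2 l2 erefl erefl _ tc.
have {}h1 := h1 ltac:(rewrite /= inE; lia) ltac:(move=> j; rewrite !inE /flipQR; lia).
lia.
Qed.

(** * Pairs with a hole, and all pairs together *)

Lemma ord3P (l : 'I_3) : [\/ l = l0, l = l1 | l = l2].
Proof.
by case: l => [[|[|[|//]]] p]; [constructor 1 | constructor 2 | constructor 3]; apply: val_inj.
Qed.

Lemma cover_hole (x y : G) l h :
  (2 <= \sum_(b <- base x) occ (lv l y) (hole m h) b)%N.
Proof.
rewrite sum_base sum_partU sum_partRP sum_partB.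
set Y := endR _; set X := endP _; set Z := X + _ - w; set z := endQ _.
have hb b l' h' p : lv l' p \in points b -> hole m h' \in points b ->
  (0 < occ (lv l' y) (hole m h') b)%N by exact: occ_hole.
case: (ord3P h) => ->.
- pose b1 : pt * pt * pt := (lv l0 x, A, lv l1 (x + w)).
  pose b2 : pt * pt * pt := (A, lv l1 (x + w), lv l2 (x + w)).
  pose b3 : pt * pt * pt := (lv l2 z, lv l0 (z - 2%:R), A).
  rewrite -/b1 -/b2 -/b3; case: (ord3P l) => ->.
  + have := hb b1 l0 l0 x; have := hb b3 l0 l0 (z - 2%:R).
    rewrite !mem_points => /(_ isT isT) h1 /(_ isT isT) h2; lia.
  + have := hb b1 l1 l0 (x + w); have := hb b2 l1 l0 (x + w).
    rewrite !mem_points => /(_ isT isT) h1 /(_ isT isT) h2; lia.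
  + have := hb b2 l2 l0 (x + w); have := hb b3 l2 l0 z.
    rewrite !mem_points => /(_ isT isT) h1 /(_ isT isT) h2; lia.
- pose b1 : pt * pt * pt := (lv l0 X, lv l1 (X + 1), B).
  pose b2 : pt * pt * pt := (lv l1 (X + 1), B, lv l2 Z).
  pose b3 : pt * pt * pt := (B, lv l2 Z, lv l0 (Z - w - 1)).
  rewrite -/b1 -/b2 -/b3; case: (ord3P l) => ->.
  + have := hb b1 l0 l1 X; have := hb b3 l0 l1 (Z - w - 1).
    rewrite !mem_points => /(_ isT isT) h1 /(_ isT isT) h2; lia.
  + have := hb b1 l1 l1 (X + 1); have := hb b2 l1 l1 (X + 1).
    rewrite !mem_points => /(_ isT isT) h1 /(_ isT isT) h2; lia.
  + have := hb b2 l2 l1 Z; have := hb b3 l2 l1 Z.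
    rewrite !mem_points => /(_ isT isT) h1 /(_ isT isT) h2; lia.
- pose b1 : pt * pt * pt := (lv l1 (x + w), lv l0 (x + w), C).
  pose b2 : pt * pt * pt := (lv l0 (x + w), C, lv l2 (x + w)).
  pose b3 : pt * pt * pt := (C, lv l2 (x + w), lv l1 (x + w - 1)).
  rewrite -/b1 -/b2 -/b3; case: (ord3P l) => ->.
  + have := hb b1 l0 l2 (x + w); have := hb b2 l0 l2 (x + w).
    rewrite !mem_points => /(_ isT isT) h1 /(_ isT isT) h2; lia.
  + have := hb b1 l1 l2 (x + w); have := hb b3 l1 l2 (x + w - 1).
    rewrite !mem_points => /(_ isT isT) h1 /(_ isT isT) h2; lia.
  + have := hb b2 l2 l2 (x + w); have := hb b3 l2 l2 (x + w).
    rewrite !mem_points => /(_ isT isT) h1 /(_ isT isT) h2; lia.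
Qed.

(** A sum coerces to [true] on its left summand, so exactly the pairs inside [{A, B, C}] are left
    out. *)
Lemma cover_base (x : G) (u u' : pt) : u != u' -> (u : bool) || (u' : bool) ->
  (2 <= \sum_(b <- base x) occ u u' b)%N.
Proof.
have occC v v' : (\sum_(b <- base x) occ v v' b = \sum_(b <- base x) occ v' v b)%N.
  by apply: eq_bigr => b _; rewrite occ_sym.
case: u u' => [[y l]|h] [[y' l']|h'] // neq _; last 2 first.
- exact: (cover_hole x y l h').
- by rewrite occC; exact: (cover_hole x y' l' h).
rewrite -/(lv l y) -/(lv l' y').
have yE (v v' : G) : v' = v + (v' - v) by ring.
have pure : l = l' -> y' - y != 0.
  by move=> ll'; rewrite subr_eq0; apply: contra neq => /eqP->; rewrite ll'.
case: (ord3P l) (ord3P l') pure => -> [] -> pure.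
- by rewrite (yE y y'); apply: cover_pure0; apply: pure.
- by rewrite (yE y y'); apply: cover_mixedP.
- by rewrite occC (yE y' y); apply: cover_mixedQ.
- by rewrite occC (yE y' y); apply: cover_mixedP.
- by rewrite (yE y y'); apply: cover_pure1; apply: pure.
- by rewrite (yE y y'); apply: cover_mixedR.
- by rewrite (yE y y'); apply: cover_mixedQ.
- by rewrite occC (yE y' y); apply: cover_mixedR.
- by rewrite (yE y y'); apply: cover_pure2; apply: pure.
Qed.

(* The translates of the transversal, and [A B C]. *)
Definition vertical (b : pt * pt * pt) : bool :=
  match b with
  | (inl p, inl q, inl r) => (p.1 == q.1) && (q.1 == r.1)
  | (inr _, inr _, inr _) => true
  | _ => false
  end.

Lemma all_strand_ok la lb x d ds : la != lb -> (forall e, e \in steps d ds -> e.1.1 != e.1.2) ->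
  all (fun b => uniq (points b) && ~~ vertical b) (strand la lb x d ds).
Proof.
move=> ll dsN; apply: strand_all => y [[d1 d2] f] /dsN /= neq; rewrite /sblk.
have lvE l z l' z' : (@lv m l z == lv l' z') = (z == z') && (l == l') by [].
case: f; rewrite /= !inE !lvE !eqxx ?[lb == la]eq_sym (negbTE ll) ?andbF ?andbT /= ?orbF.
  have -> : (y == y + d1 - d2) = false.
    by apply/negbTE; rewrite eq_sym -subr_eq0 (_ : _ - _ = d1 - d2) ?subr_eq0 //; ring.
  rewrite /=; apply: contra neq => /andP[/eqP e1 /eqP e2].
  have := congr1 (fun v => v - y) e1; rewrite subrr addrAC subrr add0r => <-.
  have := congr1 (fun v => v - (y + d1)) e2; rewrite subrr addrAC subrr add0r.
  by move/eqP; rewrite !(eq_sym 0) oppr_eq0.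
rewrite (inj_eq (addrI y)) neq /=; apply: contra neq => /andP[/eqP e1 /eqP e2].
by rewrite -(inj_eq (addrI y)) e1 -e2.
Qed.

Lemma kappa_shift k (p q : G) : (0 < k < n)%N -> p - q = k%:R * kappa ->
  ((p == q) = false) * ((q == p) = false).
Proof.
move=> kn pq; have npq : (p == q) = false by apply/negbTE; rewrite -subr_eq0 pq kappa_neq0.
by split; rewrite // eq_sym.
Qed.

Lemma all_strand_uniq la lb x d ds : la != lb ->
  (forall e, e \in steps d ds -> e.1.1 != e.1.2) ->
  all (fun b => uniq (points b)) (strand la lb x d ds) /\ count vertical (strand la lb x d ds) = 0%N.
Proof.
move=> ll dsN; have := all_strand_ok x ll dsN; rewrite all_predI => /andP[-> hm]; split=> //.
by apply/eqP; rewrite -leqn0 leqNgt -has_count -all_predC.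
Qed.

Lemma partB_blocks X Z p :
  all (fun b => uniq (points b)) (partB X Z p) /\ count vertical (partB X Z p) = 0%N.
Proof.
have n2 : (0 < 2 < n)%N by lia.
have n3 : (0 < 3 < n)%N by lia.
have kp := @kappa_shift 1 (p + kappa) p isT ltac:(ring).
have kp2 := @kappa_shift 2 p (p - 2%:R * kappa) n2 ltac:(ring).
have kp3 := @kappa_shift 3 (p + kappa) (p - 2%:R * kappa) n3 ltac:(ring).
rewrite /partB; move: (p + kappa) (p - 2%:R * kappa) (Z - kappa) (X + 1) kp kp2 kp3.
move=> q r Z' X' [pq qp] [pr rp] [qr rq].
have lvE l u l' u' : (@lv m l u == lv l' u') = (u == u') && (l == l') by [].
by split; rewrite /= ?inE ?lvE ?qp ?pq ?pr ?qr ?andbF.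
Qed.

Lemma base_blocks x :
  all (fun b => uniq (points b)) (base x) /\ count vertical (base x) = 1%N.
Proof.
rewrite /base; set Y := endR _; set X := endP _; set Z := X + _ - w; set p := Z - w - 1.
have lvE l z l' z' : (@lv m l z == lv l' z') = (z == z') && (l == l') by [].
have [uR mR] := all_strand_uniq (x + w - 1) (isT : l1 != l2) stepsR_neq.
have [uP mP] := all_strand_uniq (Y - a m) (isT : l0 != l1) stepsP_neq.
have [uQ mQ] := all_strand_uniq (Z - kappa) (isT : l2 != l0) stepsQ_neq.
have kY := @kappa_shift 1 (Y + kappa) Y isT ltac:(ring).
have [u1 m1] : all (fun b => uniq (points b)) (partU (x + w)) /\ count vertical (partU (x + w)) = 1%N.
  by rewrite /= !inE !lvE /= !andbF !eqxx.
have [u2 m2] : all (fun b => uniq (points b)) (partRP Y) /\ count vertical (partRP Y) = 0%N.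
  by rewrite /= !inE !lvE /= !andbF !kY ?andbF.
have [u3 m3] := partB_blocks X Z p.
rewrite -(cat1s _ (partU _ ++ _)) !all_cat u1 uR u2 uP u3 uQ !count_cat m1 mR m2 mP m3 mQ.
by rewrite /= !inE !lvE /= ?andbF.
Qed.

(** * Assembly of the cycle and the Pasch trade *)

Lemma size_strand la lb x d ds : size (@strand m la lb x d ds) = size ds.
Proof.
by elim: ds x d => // [[d' f] ds] IHds x d; apply: (congr1 S); apply: IHds.
Qed.

(** The [n] translates together with the two extra blocks from the trade give
    [n * (3n + 5) + 2 = (n + 1) * (3n + 2)], the block number for [v = 3n + 3]. *)
Lemma size_base x : size (base x) = (3 * n + 5)%N.
Proof.
have sR : size dsR = (m - 1)%N by rewrite /= size_map size_iota; lia.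
have sP : size dsP = (m - 1)%N by rewrite size_map size_rev size_iota.
have sQ : size dsQ2 = (m - 2)%N by rewrite size_cat size_map size_rev size_iota /=; lia.
by rewrite /base -(cat1s _ (partU _ ++ _)) !size_cat !size_strand sR sP sQ /=; lia.
Qed.

Lemma pasch_arith k1 k2 k3 cM cL cN : (k1 + k2 + k3 <= cN -> cL + k2 + k3 = cM + cN ->
  k1 + cM <= cL)%N.
Proof. lia. Qed.

Lemma pasch_size s s' k : (s + 1 + 1 = s' + 5 -> s'.+1 = k -> s = k + 2)%N.
Proof. lia. Qed.

Lemma parallel_strip_family : parallel_strip pt.
Proof.
have [c gc] := base_end_gen; set g := base_end 0 in gc.
(* The points of the trade: [(x, A, y)] opens the cycle, and [(B, z, x)] and [(C, z, y)] are
   translates of the blocks [{B, Z_2, (Z - w - 1)_0}] and [{C, w_2, (w - 1)_1}] of the base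
   strip. *)
pose x : pt := lv l0 0; pose y : pt := lv l1 w; pose z : pt := lv l2 (w + 1).
pose M := rounds g (base 0) n.
have [M' defM] : exists M', M = (x, A, y) :: M'.
  by have := rounds_cons g (x, A, y) (behead (base 0)); rewrite /x /y -{1}[w]add0r.
have wM : walk (x, A) M (x, A).
  apply: walk_rounds; suff -> : (tr g (x, A).1, tr g (x, A).2) = (lv l0 g, A) by exact: walk_base.
  by rewrite /x /lv /= add0r.
have memM s b : b \in base 0 -> trb s b \in M by move=> bL; exact: (mem_rounds gc s bL).
have BM' : (B, z, x) \in M'.
  pose Z := endP (endR (0 + w - 1) - a m) + 2%:R - w.
  have : trb (w + 1 - Z) (B, lv l2 Z, lv l0 (Z - w - 1)) \in M.
    apply: memM; rewrite /base -/Z inE !mem_cat; apply/orP; right.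
    by do 4![apply/orP; right]; apply/orP; left; rewrite !inE eqxx !orbT.
  rewrite /trb /= (_ : Z + (w + 1 - Z) = w + 1); last by ring.
  rewrite (_ : Z - w - 1 + (w + 1 - Z) = 0); last by ring.
  by rewrite defM inE => /orP[/eqP[]|].
have CM' : (C, z, y) \in M'.
  have : trb 1 (C, lv l2 (0 + w), lv l1 (0 + w - 1)) \in M.
    apply: memM; rewrite /base inE !mem_cat; apply/orP; right; apply/orP; left.
    by rewrite !inE eqxx !orbT.
  rewrite /trb /= add0r subrK.
  by rewrite defM inE => /orP[/eqP[]|].
have wM' : walk (x, A) ((x, A, y) :: M') (x, A) by rewrite -defM.
have [L cycL cntL] := pasch_walk wM' BM' CM' isT.
pose new := [:: (x, A, B); (B, A, C); (C, A, y); (B, z, C); (x, z, y)].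
have cntM pr : (count pr M = pr (x, A, y) + count pr M')%N by rewrite defM.
have lvE l u l' u' : (@lv m l u == lv l' u') = (u == u') && (l == l') by [].
have ux : uniq [:: A; B; C; x; y; z] by rewrite /= !inE !lvE !andbF.
have [/allP uB mB] := base_blocks 0.
have flip_points (b : pt * pt * pt) : points (flip b) = rev (points b) by [].
(* Only [(B, A, C)] is vertical: in [(x, z, y)] the coordinates [w + 1] and [w] differ. *)
have marknew : count vertical new = 1%N.
  have w1 : (w + 1 == w) = false.
    by rewrite -subr_eq0 addrAC subrr add0r (@natG_eq0 m 1).
  by rewrite /= w1 andbF.
have mark_flip b : vertical (flip b) = vertical b.
  case: b => [[[[u l]|h] [[u' l']|h']] [[u'' l'']|h'']] //=.
  by rewrite [u'' == _]eq_sym [u' == u]eq_sym andbC.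
have mark_tr s b : vertical (trb s b) = vertical b.
  by case: b => [[[[u l]|h] [[u' l']|h']] [[u'' l'']|h'']] //=; rewrite !(inj_eq (addIr s)).
have markM : count vertical M = n.
  rewrite (count_rounds gc) (eq_bigr (fun b => if vertical b then n else 0%N)).
    by rewrite -big_mkcond big_const_seq mB /= addn0.
  move=> b _; case mb: (vertical b).
    by rewrite (eq_card (B := predT)) ?card_ord // => s; rewrite !inE mark_tr mb.
  by apply: eq_card0 => s; rewrite !inE mark_tr mb.
have uniqM : count (fun b => ~~ uniq (points b)) M = 0%N.
  rewrite (count_rounds gc) big1_seq // => b /andP[_ /uB ub]; apply: eq_card0 => s.
  by rewrite !inE -[points _]/(map (tr s) (points b)) map_inj_uniq ?ub //; apply: tr_inj.
have uniqnew : count (fun b => ~~ uniq (points b)) new = 0%N.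
  by rewrite /= !inE !lvE !andbF.
have sizeM : size M = (n * (3 * n + 5))%N.
  rewrite -count_predT (count_rounds gc) (eq_bigr (fun=> n)).
    by rewrite big_const_seq count_predT iter_addn_0 size_base.
  by move=> b _; rewrite (eq_card (B := predT)) ?card_ord // => s; rewrite !inE.
have card_pt : #|{: pt}| = (3 * n + 3)%N by rewrite card_sum card_prod !card_ord mulnC.
have le_count (u u' : pt) : u != u' -> (count (covers u u') M <= count (covers u u') L)%N.
  move=> neq; have := cntL (covers u u'); have := pasch_covers ux neq.
  rewrite cntM => h1 h2; apply: pasch_arith h1 (h2 _) => b.
  by rewrite /covers flip_points !mem_rev.
(* The trade removes no vertical block, so on vertical blocks the counts simply add. *)
have count_mark (pr : pred (pt * pt * pt)) : (forall b, pr b -> vertical b) ->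
    (forall b, pr (flip b) = pr b) -> count pr L = (count pr M + count pr new)%N.
  move=> prm prf; have prF b : vertical b = false -> pr b = false.
    by move=> mb; apply/negP => /prm; rewrite mb.
  have := cntL pr prf; rewrite cntM (prF (x, A, y)) // (prF (B, z, x)) // (prF (C, z, y)) //.
  by rewrite !addn0.
exists L, vertical; split.
- split=> //.
  + pose nu (b : pt * pt * pt) := ~~ uniq (points b).
    have nu_flip b : nu (flip b) = nu b by rewrite /nu flip_points rev_uniq.
    have /esym/eqP := cntM nu; rewrite uniqM addn_eq0 => /andP[_ /eqP h2].
    have /eqP := cntL nu nu_flip; rewrite uniqnew h2 !addn_eq0.
    move=> /andP[/andP[/eqP h3 _] _].
    rewrite -[all _ _]negbK -has_predC has_count -leqNgt.
    by rewrite -[X in (X <= 0)%N]/(count nu L) h3.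
  + have szL : size L = (n * (3 * n + 5) + 2)%N.
      have := cntL predT (fun=> erefl); rewrite !count_predT => h.
      by apply: pasch_size h _; rewrite -sizeM defM.
    by rewrite szL card_pt [(3 * n + 3)%N]addnS /=; ring.
  + move=> u u' neq; case: (boolP ((u : bool) || (u' : bool))) => [hu|].
      apply: leq_trans (le_count u u' neq); rewrite (count_rounds gc).
      exact: cover_base.
    (* Pairs inside [{A, B, C}] lie only in new blocks: in [(B, A, C)] and in one of [(x, A, B)],
       [(C, A, y)], [(B, z, C)]. *)
    case: u u' neq => [//|h] [//|h'] neq _.
    have := cntL (covers (hole m h) (hole m h')).
    move=> /(_ ltac:(by move=> b; rewrite /covers flip_points !mem_rev)).
    have -> : covers (hole m h) (hole m h') (B, z, x) = false.
      by rewrite /covers /points /= !inE; case: (ord3P h) (ord3P h') neq => -> [] ->.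
    have -> : covers (hole m h) (hole m h') (C, z, y) = false.
      by rewrite /covers /points /= !inE; case: (ord3P h) (ord3P h') neq => -> [] ->.
    have : (2 <= count (covers (hole m h) (hole m h')) new)%N.
      by case: (ord3P h) (ord3P h') neq => -> [] ->.
    by rewrite !addn0 => h1 ->; apply: leq_trans h1 (leq_addl _ _).
- move=> u; apply/hasP; rewrite has_count count_mark; first last.
  + by move=> b; rewrite mark_flip flip_points mem_rev.
  + by move=> b /andP[].
  rewrite addn_gt0 -!has_count; case: u => [[v l]|h]; apply/orP; [left | right].
    apply/hasP; exists (trb (v - (0 + w)) (lv l2 (0 + w), lv l1 (0 + w), lv l0 (0 + w))).
      by apply: memM; rewrite /base inE !mem_cat /partU !inE eqxx !orbT.
    rewrite mark_tr /= !eqxx /trb /points /= subrKC !inE !lvE !eqxx.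
    by case: (ord3P l) => ->; rewrite ?orbT.
  by apply/hasP; exists (B, A, C); rewrite ?inE ?eqxx ?orbT //; case: (ord3P h) => ->.
by rewrite count_mark // markM marknew card_pt; lia.
Qed.

End Family.

(** * The spectrum *)

Lemma parallel_strip_exists k : 2 < k ->
  exists2 P : finType, #|P| = (3 * k)%N & parallel_strip P.
Proof.
move=> k3; have [k8|k8] := ltnP 7 k.
  (* Here [k = n + 1] and [n = m + 2], so [7 < k] is the condition [n >= 7] of the family. *)
  have [m km] : exists m, k = m.+3 by exists (k - 3)%N; lia.
  exists ('I_m.+2 * 'I_3 + 'I_3)%type.
    by rewrite card_sum card_prod !card_ord; lia.
  by apply: parallel_strip_family; lia.
have : k \in [:: 3; 4; 5; 6; 7] by rewrite !inE; lia.
rewrite !inE; case/or4P=> [/eqP->|/eqP->|/eqP->|/orP[]/eqP->].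
- by exists 'I_9; [rewrite card_ord | apply: parallel_strip9].
- by exists 'I_12; [rewrite card_ord | apply: parallel_strip12].
- by exists 'I_15; [rewrite card_ord | apply: parallel_strip15].
- by exists 'I_18; [rewrite card_ord | apply: parallel_strip18].
- by exists 'I_21; [rewrite card_ord | apply: parallel_strip21].
Qed.

Lemma hamiltonian_TTS_mod3 v : (8 < v)%N -> (v %% 3 < 2)%N ->
  exists S : TTS v, hamiltonian (two_BIG S).
Proof.
move=> v8 v3; have [|P cardP stripP] := @parallel_strip_exists (v %/ 3); first by lia.
have P3 : (3 < #|P|)%N by rewrite cardP; lia.
have := parallel_strip_hamiltonian P3 stripP; rewrite cardP => -[hP hP1].
have [vE|vE] : v = (3 * (v %/ 3))%N \/ v = (3 * (v %/ 3)).+1 by lia.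
  by rewrite vE.
by rewrite vE.
Qed.

Theorem theorem1p3 (v : nat) (hv : 3 <= v) :
  (exists S : TTS v, hamiltonian (two_BIG S)) <->
  (v = 0 %[mod 3] \/ v = 1 %[mod 3]) /\ v \notin [:: 3; 6].
Proof.
split=> [[S hamS]|[vmod vn]]; first exact: hamiltonian_TTS_order hamS.
have [v8|v8] := ltnP 8 v; first by apply: hamiltonian_TTS_mod3 => //; lia.
have [->|->] : v = 4 \/ v = 7 by move: vn; rewrite !inE; lia.
  exact: hamiltonian_TTS4.
exact: hamiltonian_TTS7.
Qed.
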